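(* Let $\alpha_0,\dots,\alpha_5$ be complex parameters with $\alpha_0+\alpha_1+2\alpha_2+2\alpha_3+2\alpha_4+2\alpha_5=1$, and consider the system \begin{align*} \frac{dx}{dt}&=-\frac{2x^3y-2x^2y+(\alpha_1+2\alpha_2)x^2+(t-1+2\alpha_3+2\alpha_4+2\alpha_5)x-t}{t}-\frac{2(x-1)z(zw+\alpha_4)}{t},\\ \frac{dy}{dt}&=\frac{3x^2y^2-2xy^2+2(\alpha_1+2\alpha_2)xy+(t-1+2\alpha_3+2\alpha_4+2\alpha_5)y+\alpha_2(\alpha_1+\alpha_2)}{t}+\frac{2yz(zw+\alpha_4)}{t},\\ \frac{dz}{dt}&=-\frac{2z^3w-2z^2w+(\alpha_1+2\alpha_2+\alpha_3+2\alpha_4)z^2+(t-1+2\alpha_5)z-t}{t}-\frac{2(x-1)yz^2}{t},\\ \frac{dw}{dt}&=\frac{3z^2w^2-2zw^2+2(\alpha_1+2\alpha_2+\alpha_3+2\alpha_4)zw+(t-1+2\alpha_5)w}{t}\\ &\quad+\frac{\alpha_4(\alpha_1+2\alpha_2+\alpha_3+\alpha_4)+2(x-1)y(2zw+\alpha_4)}{t}. \end{align*} This system admits extended affine Weyl group symmetry of type $B_5^{(1)}$ as a group of Bäcklund transformations, with generators acting on $(x,y,z,w,t;\alpha_0,\dots,\alpha_5)$ by \begin{align*} s_0:&\ \to \left(x,y-\tfrac{\alpha_0}{x-1},z,w,t;-\alpha_0,\alpha_1,\alpha_2+\alpha_0,\alpha_3,\alpha_4,\alpha_5\right),\\ s_1:&\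 \to (x,y,z,w,t;\alpha_0,-\alpha_1,\alpha_2+\alpha_1,\alpha_3,\alpha_4,\alpha_5),\\ s_2:&\ \to \left(x+\tfrac{\alpha_2}{y},y,z,w,t;\alpha_0+\alpha_2,\alpha_1+\alpha_2,-\alpha_2,\alpha_3+\alpha_2,\alpha_4,\alpha_5\right),\\ s_3:&\ \to \left(x,y-\tfrac{\alpha_3}{x-z},z,w+\tfrac{\alpha_3}{x-z},t;\alpha_0,\alpha_1,\alpha_2+\alpha_3,-\alpha_3,\alpha_4+\alpha_3,\alpha_5\right),\\ s_4:&\ \to \left(x,y,z+\tfrac{\alpha_4}{w},w,t;\alpha_0,\alpha_1,\alpha_2,\alpha_3+\alpha_4,-\alpha_4,\alpha_5+\alpha_4\right),\\ s_5:&\ \to \left(x,y,z,w-\tfrac{2\alpha_5}{z}+\tfrac{t}{z^2},-t;\alpha_0,\alpha_1,\alpha_2,\alpha_3,\alpha_4+2\alpha_5,-\alpha_5\right),\\ \pi:&\ \to \Big(\tfrac{x}{x-1},-(x-1)((x-1)y+\alpha_2),\tfrac{z}{z-1},-(z-1)((z-1)w+\alpha_4),-t;\alpha_1,\alpha_0,\alpha_2,\alpha_3,\alpha_4,\alpha_5\Big). \end{align*} That is: each of $s_0,\dots,s_5,\pi$ is a Bäcklund transformation of the system; the group generated by $s_0,\dots,s_5$ is the affine Weyl group of type $B_5^{(1)}$ with these as simple reflections (defining relations $s_i^2=1$; $(s_0s_2)^3=(s_1s_2)^3=(s_2s_3)^3=(s_3s_4)^3=1$; $(s_4s_5)^4=1$;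 all other pairs commute); and $\pi$ realizes the diagram automorphism: $\pi^2=1$, $\pi s_0=s_1\pi$, $\pi s_i=s_i\pi$ for $i=2,3,4,5$.
   Context: A transformation $(x,y,z,w,t;\alpha)\mapsto(x',y',z',w',t';\alpha')$, with $x',y',z',w',t'$ rational in $x,y,z,w,t,\alpha$, is a Bäcklund transformation of the system if, whenever $(x,y,z,w)(t)$ solves the system with parameters $\alpha$, the tuple $(x',y',z',w')$, viewed as a function of the independent variable $t'$ (where defined), solves the same system with parameters $\alpha'$. Such transformations are composed as automorphisms of the field of rational functions in $x,y,z,w,t$ and the parameters (subject to their linear relation): e.g. $s_0(y)=y-\alpha_0/(x-1)$, $s_0(\alpha_2)=\alpha_2+\alpha_0$. *)

(* Defs.v *)
From HB Require Import structures.
From mathcomp Require Import all_boot all_order all_algebra.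
From mathcomp Require Import generic_quotient complex.
From mathcomp Require Import classical_sets reals topology normedtype derive.
(* The notations of mpoly clash with those of MathComp-Analysis. *)
From mathcomp.multinomials Require Import -(notations) mpoly.
Import numFieldNormedType.Exports.
Set Implicit Arguments.
Unset Strict Implicit.
Unset Printing Implicit Defensive.
Import Order.TTheory GRing.Theory Num.Theory.
Local Open Scope ring_scope.
Local Open Scope complex_scope.

Definition linear_relation (R : realType) (a : 6.-tuple R[i]) : Prop :=
  a`_0 + a`_1 + 2 * a`_2 + 2 * a`_3 + 2 * a`_4 + 2 * a`_5 = 1.

Definition vector_field (R : realType) (a : 6.-tuple R[i]) (t : R[i])
    (X : 4.-tuple R[i]) : 4.-tuple R[i] :=
  let x := X`_0 in let y := X`_1 in let z := X`_2 in let w := X`_3 in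
  let a1 := a`_1 in let a2 := a`_2 in let a3 := a`_3 in
  let a4 := a`_4 in let a5 := a`_5 in
  [tuple
    - ((2 * x ^+ 3 * y - 2 * x ^+ 2 * y + (a1 + 2 * a2) * x ^+ 2
        + (t - 1 + 2 * a3 + 2 * a4 + 2 * a5) * x - t) / t)
    - 2 * (x - 1) * z * (z * w + a4) / t;

    (3 * x ^+ 2 * y ^+ 2 - 2 * x * y ^+ 2 + 2 * (a1 + 2 * a2) * x * y
        + (t - 1 + 2 * a3 + 2 * a4 + 2 * a5) * y + a2 * (a1 + a2)) / t
    + 2 * y * z * (z * w + a4) / t;

    - ((2 * z ^+ 3 * w - 2 * z ^+ 2 * w + (a1 + 2 * a2 + a3 + 2 * a4) * z ^+ 2
        + (t - 1 + 2 * a5) * z - t) / t)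
    - 2 * (x - 1) * y * z ^+ 2 / t;

    (3 * z ^+ 2 * w ^+ 2 - 2 * z * w ^+ 2
        + 2 * (a1 + 2 * a2 + a3 + 2 * a4) * z * w + (t - 1 + 2 * a5) * w) / t
    + (a4 * (a1 + 2 * a2 + a3 + a4) + 2 * (x - 1) * y * (2 * z * w + a4)) / t].

(* Over the field R[i] the derivative in the direction 1 is the complex one;
   R[i]^o carries the norm topology. *)
Definition is_solution (R : realType) (a : 6.-tuple R[i]) (U : set R[i]^o)
    (X : R[i] -> 4.-tuple R[i]) : Prop :=
  [/\ open U, ~ U 0 &
    forall t, U t -> forall i : 'I_4,
      is_derive (t : R[i]^o) 1 (fun u : R[i]^o => tnth (X u) i : R[i]^o)
        (tnth (vector_field a t (X t)) i)].

(* Free variables, in order: x, y, z, w, t, alpha_1, ..., alpha_5; alpha_0 is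
   eliminated by the linear relation. *)
Definition polys (R : realType) := mpoly 10 R[i].
Definition ratfun (R : realType) : fieldType := {fraction polys R}.

Definition of_poly (R : realType) (p : polys R) : ratfun R :=
  @FracField.tofrac (polys R) p.

Definition constf (R : realType) (c : R[i]) : ratfun R :=
  of_poly (mpolyC 10 c).

Definition varf (R : realType) (k : nat) : ratfun R :=
  of_poly (mpolyX R[i] (mnm1 (inord k : 'I_10))).

(* Coordinate systems (x, y, z, w, t; alpha_0, ..., alpha_5) are 11-tuples. *)
Definition coords (R : realType) : 11.-tuple (ratfun R) :=
  [tuple varf R 0; varf R 1; varf R 2; varf R 3; varf R 4;
    1 - varf R 5 - 2 * varf R 6 - 2 * varf R 7 - 2 * varf R 8 - 2 * varf R 9;
    varf R 5; varf R 6; varf R 7; varf R 8; varf R 9].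

Definition drop_alpha0 (A : Type) (p : 11.-tuple A) (i : 'I_10) : A :=
  tnth p (lift (inord 5) i).

(* f is regular at the point p, with value v *)
Definition evaluates_to (R : realType) (f : ratfun R) (p : 11.-tuple R[i])
    (v : R[i]) : Prop :=
  exists n d : polys R,
    [/\ f = of_poly n / of_poly d, meval (drop_alpha0 p) d != 0 &
        v = meval (drop_alpha0 p) n / meval (drop_alpha0 p) d].

(* A transformation is the 11-tuple (x', y', z', w', t'; alpha'). *)
Definition transformation (R : realType) := 11.-tuple (ratfun R).

Definition maps_to (R : realType) (T : transformation R)
    (p q : 11.-tuple R[i]) : Prop :=
  forall i : 'I_11, evaluates_to (tnth T i) p (tnth q i).

Definition mk_point (R : realType) (X : 4.-tuple R[i]) (t : R[i])
    (a : 6.-tuple R[i]) : 11.-tuple R[i] :=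
  [tuple of X ++ t :: a].

(* The new independent variable is s = t'; theta is a continuous branch of
   the inverse of t |-> t' along the solution X, on an open set V of values of
   t' where the transformation is defined. *)
Definition is_backlund (R : realType) (T : transformation R) : Prop :=
  forall a : 6.-tuple R[i], linear_relation a ->
  exists2 a' : 6.-tuple R[i], linear_relation a' &
  forall (U : set R[i]^o) (X : R[i] -> 4.-tuple R[i]), is_solution a U X ->
  forall (V : set R[i]^o) (theta : R[i]^o -> R[i]^o)
    (Y : R[i] -> 4.-tuple R[i]) (A : R[i] -> 6.-tuple R[i]),
  open V ->
  (forall s, V s ->
    [/\ U (theta s), {for s, continuous theta} &
        maps_to T (mk_point (X (theta s)) (theta s) a)
                  (mk_point (Y s) s (A s))]) ->
  is_solution a' V Y /\ (forall s, V s -> A s = a').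

(* Substitution of T for the coordinates in a rational function; the value is
   meaningful when the substituted denominator is nonzero. *)
Definition act (R : realType) (T : transformation R) (f : ratfun R) :
    ratfun R :=
  let r := repr (f : {fraction polys R}) in
  mmap (@constf R) (drop_alpha0 T) \n_r / mmap (@constf R) (drop_alpha0 T) \d_r.

Definition is_automorphism (R : realType) (sigma : ratfun R -> ratfun R) :
    Prop :=
  exists g : {rmorphism ratfun R -> ratfun R},
    [/\ sigma =1 g, bijective g & forall c, g (constf c) = constf c].

Definition acts_by (R : realType) (T : transformation R) : Prop :=
  is_automorphism (act T) /\
  forall i : 'I_11, act T (tnth (coords R) i) = tnth T i.

Definition refl_s (R : realType) (i : 'I_6) : transformation R :=
  let v := tnth (coords R) in
  let x := v (inord 0) in let y := v (inord 1) in
  let z := v (inord 2) in let w := v (inord 3) in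
  let t := v (inord 4) in
  let a0 := v (inord 5) in let a1 := v (inord 6) in
  let a2 := v (inord 7) in let a3 := v (inord 8) in
  let a4 := v (inord 9) in let a5 := v (inord 10) in
  tnth [tuple
    [tuple x; y - a0 / (x - 1); z; w; t; - a0; a1; a2 + a0; a3; a4; a5];
    [tuple x; y; z; w; t; a0; - a1; a2 + a1; a3; a4; a5];
    [tuple x + a2 / y; y; z; w; t; a0 + a2; a1 + a2; - a2; a3 + a2; a4; a5];
    [tuple x; y - a3 / (x - z); z; w + a3 / (x - z); t;
           a0; a1; a2 + a3; - a3; a4 + a3; a5];
    [tuple x; y; z + a4 / w; w; t; a0; a1; a2; a3 + a4; - a4; a5 + a4];
    [tuple x; y; z; w - 2 * a5 / z + t / z ^+ 2; - t;
           a0; a1; a2; a3; a4 + 2 * a5; - a5]] i.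

Definition diag_pi (R : realType) : transformation R :=
  let v := tnth (coords R) in
  let x := v (inord 0) in let y := v (inord 1) in
  let z := v (inord 2) in let w := v (inord 3) in
  let t := v (inord 4) in
  let a0 := v (inord 5) in let a1 := v (inord 6) in
  let a2 := v (inord 7) in let a3 := v (inord 8) in
  let a4 := v (inord 9) in let a5 := v (inord 10) in
  [tuple x / (x - 1); - (x - 1) * ((x - 1) * y + a2);
         z / (z - 1); - (z - 1) * ((z - 1) * w + a4); - t;
         a1; a0; a2; a3; a4; a5].

(* The word [:: i; j; ...] acts as the composite s_i \o s_j \o ... *)
Definition act_word (R : realType) (u : seq 'I_6) (f : ratfun R) : ratfun R :=
  foldr (fun i g => act (refl_s R i) g) f u.

Definition coxeter_matrix (i j : 'I_6) : nat :=
  (let e := (minn i j, maxn i j) in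
   if i == j then 1
   else if e \in [:: (0, 2); (1, 2); (2, 3); (3, 4)] then 3
   else if e == (4, 5) then 4
   else 2)%N.

(* Equality in the Coxeter group of type B_5^(1), i.e. the affine Weyl group:
   the congruence on words generated by (s_i s_j)^(m i j) = 1. As m i i = 1,
   every generator is an involution, so words already represent all elements
   of the group. *)
Inductive coxeter_eq : seq 'I_6 -> seq 'I_6 -> Prop :=
| Coxeter_rel u v i j :
    coxeter_eq (u ++ flatten (nseq (coxeter_matrix i j) [:: i; j]) ++ v)
               (u ++ v)
| Coxeter_refl u : coxeter_eq u u
| Coxeter_sym u v : coxeter_eq u v -> coxeter_eq v u
| Coxeter_trans u v w : coxeter_eq u v -> coxeter_eq v w -> coxeter_eq u w.

(* Main.v *)
Require Import Defs.
From HB Require Import structures.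
From mathcomp Require Import all_boot all_order all_algebra.
From mathcomp Require Import generic_quotient complex.
From mathcomp Require Import boolp classical_sets reals topology normedtype derive.
From mathcomp.multinomials Require Import -(notations) mpoly.
From mathcomp Require Import ring.
Import numFieldNormedType.Exports.
Set Implicit Arguments.
Unset Strict Implicit.
Unset Printing Implicit Defensive.
Import Order.TTheory GRing.Theory Num.Theory.
Local Open Scope ring_scope.
Local Open Scope complex_scope.

(* A birational map is handled through the relation "f is regular at phi with
   value v", where phi is a ring morphism from the polynomials to a field.
   Since each generator is an involution on a point with generic coordinates,
   substituting it into polynomials is injective, so its action extends to an
   automorphism of the function field, and relations between generators are
   rational identities at a point of an arbitrary field.

   For the faithfulness of the action of the Coxeter group we follow Tits: at
   the point of the alcove where all alpha_i equal 1/10, u(alpha_s) takes a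
   nonnegative value whenever u and u s are reduced words, by induction on the
   length of u and a computation in the dihedral group of s and another
   generator.

   For the Baecklund property, the value of a generator along a solution is
   first shown to be given by its formula: a denominator vanishing at a special
   value of the parameters would be a genuine pole, as seen by moving the
   parameters.  The transformed system is then a rational identity. *)

(** * Regular values of rational functions *)

Section Regular.
Variables (P : idomainType) (K : fieldType) (phi : {rmorphism P -> K}).
Local Notation "p %:F" := (@FracField.tofrac P p).
Implicit Types (f g : {fraction P}) (u v : K).

(* [f] extends to the local ring at the kernel of [phi], with value [v] *)
Definition regular f v : Prop :=
  exists n d : P, [/\ f = n%:F / d%:F, phi d != 0 & v = phi n / phi d].

Lemma denom_neq0 d : phi d != 0 -> d%:F != 0.
Proof. by apply: contraNneq => /eqP; rewrite tofrac_eq0 => /eqP ->; rewrite rmorph0. Qed.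

Lemma regular_tofrac p : regular p%:F (phi p).
Proof. by exists p, 1; rewrite !rmorph1 !divr1 oner_eq0. Qed.

(** Cross-multiplied, two representations of [f] give an equality in [P] itself, to which [phi]
    applies; so [regular] is a partial function even when [phi] has a kernel. *)
Lemma regular_uniq f u v : regular f u -> regular f v -> u = v.
Proof.
move=> [n [d [-> d0 ->]]] [m [e [E e0 ->]]].
apply/eqP; rewrite eqr_div // -!rmorphM; apply/eqP; congr (phi _).
apply/eqP; rewrite -tofrac_eq !rmorphM /=.
by rewrite -eqr_div ?denom_neq0 // E.
Qed.

Lemma regularD f g u v : regular f u -> regular g v -> regular (f + g) (u + v).
Proof.
move=> [n [d [-> d0 ->]]] [m [e [-> e0 ->]]].
exists (n * e + m * d), (d * e); rewrite !(rmorphM, rmorphD) /=.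
by rewrite !addf_div ?denom_neq0 // mulf_neq0.
Qed.

Lemma regularM f g u v : regular f u -> regular g v -> regular (f * g) (u * v).
Proof.
move=> [n [d [-> d0 ->]]] [m [e [-> e0 ->]]].
by exists (n * m), (d * e); rewrite !rmorphM /= !mulf_div mulf_neq0.
Qed.

Lemma regularN f u : regular f u -> regular (- f) (- u).
Proof.
move=> [n [d [-> d0 ->]]].
by exists (- n), d; rewrite !rmorphN /= !mulNr.
Qed.

Lemma regularB f g u v : regular f u -> regular g v -> regular (f - g) (u - v).
Proof. by move=> fu /regularN; apply: regularD. Qed.

Lemma regularX f u k : regular f u -> regular (f ^+ k) (u ^+ k).
Proof.
move=> fu; elim: k => [|k IH]; last by rewrite !exprS; apply: regularM.
by rewrite !expr0 -tofrac1 -(rmorph1 phi); apply: regular_tofrac.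
Qed.

Lemma regularV f u : u != 0 -> regular f u -> regular f^-1 u^-1.
Proof.
move=> u0 [n [d [-> d0 E]]]; exists d, n.
move: u0; rewrite E mulf_eq0 invr_eq0 negb_or => /andP[n0 _].
by rewrite !invf_div.
Qed.

Lemma regular_div f g u v :
  v != 0 -> regular f u -> regular g v -> regular (f / g) (u / v).
Proof. by move=> v0 fu /(regularV v0); apply: regularM. Qed.

Lemma regular_nat k : regular k%:R k%:R.
Proof.
rewrite -!(rmorph_nat (@FracField.tofrac P)) -(rmorph_nat phi).
exact: regular_tofrac.
Qed.

(** [act] is defined through the chosen representative [repr f]; this puts that choice in the form
    required by [regular]. *)
Lemma fraction_repr f : f = (\n_(repr f))%:F / (\d_(repr f))%:F.
Proof.
have d0 : (\d_(repr f))%:F != 0 by rewrite tofrac_eq0 denom_ratioP.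
apply: (mulIf d0); rewrite divfK // -{1}[f]reprK.
unlock FracField.tofrac; rewrite -[LHS]FracField.pi_mul /FracField.mulf.
rewrite !numden_Ratio ?oner_eq0 //= mulr1.
apply/eqmodP => /=.
rewrite FracField.equivfE !numden_Ratio ?mulr1 ?oner_eq0 ?denom_ratioP //.
by rewrite mulrC.
Qed.

Hypothesis phi_inj : forall p, phi p = 0 -> p = 0.

Lemma regular_repr f :
  regular f (phi \n_(repr f) / phi \d_(repr f)).
Proof.
exists (\n_(repr f)), (\d_(repr f)); split=> //; first exact: fraction_repr.
by apply/eqP => /phi_inj/eqP; rewrite (negbTE (denom_ratioP _)).
Qed.

End Regular.

(** * The generators at a point over an arbitrary field *)

(* The index 6 stands for [pi]. *)
Definition generator (F : fieldType) (i : nat) (p : 11.-tuple F) :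
    11.-tuple F :=
  let x := p`_0 in let y := p`_1 in let z := p`_2 in let w := p`_3 in
  let t := p`_4 in
  let a0 := p`_5 in let a1 := p`_6 in let a2 := p`_7 in
  let a3 := p`_8 in let a4 := p`_9 in let a5 := p`_10 in
  match i with
  | 0 => [tuple x; y - a0 / (x - 1); z; w; t; - a0; a1; a2 + a0; a3; a4; a5]
  | 1 => [tuple x; y; z; w; t; a0; - a1; a2 + a1; a3; a4; a5]
  | 2 => [tuple x + a2 / y; y; z; w; t;
            a0 + a2; a1 + a2; - a2; a3 + a2; a4; a5]
  | 3 => [tuple x; y - a3 / (x - z); z; w + a3 / (x - z); t;
            a0; a1; a2 + a3; - a3; a4 + a3; a5]
  | 4 => [tuple x; y; z + a4 / w; w; t; a0; a1; a2; a3 + a4; - a4; a5 + a4]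
  | 5 => [tuple x; y; z; w - 2 * a5 / z + t / z ^+ 2; - t;
            a0; a1; a2; a3; a4 + 2 * a5; - a5]
  | _ => [tuple x / (x - 1); - (x - 1) * ((x - 1) * y + a2);
            z / (z - 1); - (z - 1) * ((z - 1) * w + a4); - t;
            a1; a0; a2; a3; a4; a5]
  end.

(** Every reciprocal in [generator i] is that of a power of this element or, for [pi], of one of its
    two factors. *)
Definition denominator (F : fieldType) (i : nat) (p : 11.-tuple F) : F :=
  let x := p`_0 in let y := p`_1 in let z := p`_2 in let w := p`_3 in
  match i with
  | 0 => x - 1 | 1 => 1 | 2 => y | 3 => x - z | 4 => w | 5 => z
  | _ => (x - 1) * (z - 1)
  end.

(** This is the linear relation solved for alpha_0, literally as [coords] eliminates it. *)
Definition normalized (F : fieldType) (p : 11.-tuple F) : Prop :=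
  p`_5 = 1 - p`_6 - 2 * p`_7 - 2 * p`_8 - 2 * p`_9 - 2 * p`_10.

Lemma tuple11_eta (A : Type) (x : A) (p : 11.-tuple A) :
  p = [tuple nth x p 0; nth x p 1; nth x p 2; nth x p 3; nth x p 4; nth x p 5;
             nth x p 6; nth x p 7; nth x p 8; nth x p 9; nth x p 10].
Proof.
case: p => s sz; apply: val_inj => /=.
by case: s sz => [|? [|? [|? [|? [|? [|? [|? [|? [|? [|? [|? []]]]]]]]]]]].
Qed.

Section GenericPoint.
Variable F : fieldType.
Implicit Type p : 11.-tuple F.

Lemma div_sub1 (u : F) : u - 1 != 0 -> u / (u - 1) - 1 = (u - 1)^-1.
Proof. by move=> u1; field. Qed.

(** Each s_i fixes the coordinates in its own denominator, and [pi] inverts both x - 1 and z - 1;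
    hence a generator can be applied twice. *)
Lemma denominator_generator i p :
  denominator i p != 0 -> denominator i (generator i p) != 0.
Proof.
case: i => [|[|[|[|[|[|i]]]]]] //=; rewrite /denominator /=.
rewrite mulf_eq0 negb_or => /andP[x1 z1].
by rewrite !div_sub1 // mulf_neq0 ?invr_eq0.
Qed.

Lemma generatorK i p : denominator i p != 0 -> generator i (generator i p) = p.
Proof.
rewrite [X in _ = X](tuple11_eta 0 p).
case: i => [|[|[|[|[|[|i]]]]]] /= d0; apply: val_inj => /=;
  rewrite /denominator /= in d0.
- by congr [:: _; _; _; _; _; _; _; _; _; _; _]; field.
- by congr [:: _; _; _; _; _; _; _; _; _; _; _]; ring.
- by congr [:: _; _; _; _; _; _; _; _; _; _; _]; field.
- by congr [:: _; _; _; _; _; _; _; _; _; _; _]; field.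
- by congr [:: _; _; _; _; _; _; _; _; _; _; _]; field.
- by congr [:: _; _; _; _; _; _; _; _; _; _; _]; field.
- move: d0; rewrite mulf_eq0 negb_or => /andP[x1 z1].
  rewrite !div_sub1 // !invrK !divfK //.
  by congr [:: _; _; _; _; _; _; _; _; _; _; _]; field.
Qed.

Lemma generator_normalized i p : normalized p -> normalized (generator i p).
Proof.
rewrite /normalized => np.
by case: i => [|[|[|[|[|[|i]]]]]] /=; rewrite np; ring.
Qed.

End GenericPoint.

(** * Compatibility of the generators with field morphisms and with regular values *)

Section GenericMaps.

Lemma map_generator (F K : fieldType) (g : {rmorphism F -> K}) i p :
  map_tuple g (generator i p) = generator i (map_tuple g p).
Proof.
rewrite (tuple11_eta 0 p).
by case: i => [|[|[|[|[|[|i]]]]]]; apply: val_inj;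
  rewrite /= ?(rmorphD, rmorphB, rmorphN, rmorphM, fmorphV, rmorphXn, rmorph1, rmorph_nat).
Qed.

Variables (P : idomainType) (K : fieldType) (phi : {rmorphism P -> K}).
Implicit Types (p : 11.-tuple {fraction P}) (q : 11.-tuple K).

Definition regular_at p q := forall k : nat, (k < 11)%N -> regular phi p`_k q`_k.

Lemma regular_denominator i p q :
  regular_at p q -> regular phi (denominator i p) (denominator i q).
Proof.
move=> pq.
have [p0 p1 p2 p3] := And4 (pq 0%N isT) (pq 1%N isT) (pq 2%N isT) (pq 3%N isT).
have r1 := regular_nat phi 1.
case: i => [|[|[|[|[|[|i]]]]]] //; rewrite /denominator.
- exact: regularB.
- exact: regularB.
- by apply: regularM; apply: regularB.
Qed.

Lemma regular_generator i p q :
  denominator i q != 0 -> regular_at p q ->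
  regular_at (generator i p) (generator i q).
Proof.
move=> d0 pq.
have [p0 p1 p2 p3] := And4 (pq 0%N isT) (pq 1%N isT) (pq 2%N isT) (pq 3%N isT).
have [p4 p5 p6] := And3 (pq 4%N isT) (pq 5%N isT) (pq 6%N isT).
have [p7 p8 p9 p10] := And4 (pq 7%N isT) (pq 8%N isT) (pq 9%N isT) (pq 10%N isT).
have r1 := regular_nat phi 1.
have r2 := regular_nat phi 2.
have rd := regular_denominator i pq.
case: i d0 rd => [|[|[|[|[|[|i]]]]]]; rewrite /denominator => d0 rd;
  do 11?[case=> [_|]] => //=;
  repeat (assumption || apply: regularB || apply: regularD || apply: regularN
          || apply: regularM || apply: regularX || apply: regularV) => //.
- exact: expf_neq0.
- by move: d0; rewrite mulf_eq0 negb_or => /andP[].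
- by move: d0; rewrite mulf_eq0 negb_or => /andP[].
Qed.

Lemma regular_neq0 f u : regular phi f u -> u != 0 -> f != 0.
Proof.
move=> fu; apply: contraNneq => f0; rewrite f0 in fu.
by rewrite (regular_uniq fu (regular_nat phi 0)).
Qed.

End GenericMaps.

(** * The action on the function field *)

Section RationalFunctions.
Variable R : realType.
Local Notation C := R[i].

HB.instance Definition _ :=
  GRing.RMorphism.copy (@of_poly R) (@FracField.tofrac (polys R)).
HB.instance Definition _ :=
  GRing.RMorphism.copy (@constf R) (@of_poly R \o @mpolyC 10 R[i]).

Definition subst (T : transformation R) : {rmorphism polys R -> ratfun R} :=
  mmap (@constf R) (drop_alpha0 T).

Lemma substX T k : subst T (mpolyX _ (mnm1 k)) = drop_alpha0 T k.
Proof. by rewrite /subst /= mmapX mmap1U. Qed.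

Lemma substC T c : subst T (mpolyC _ c) = constf c.
Proof. by rewrite /subst /= mmapC. Qed.

Lemma nth_tnth (A : Type) n (x : A) (p : n.-tuple A) k (lt_kn : (k < n)%N) :
  nth x p k = tnth p (Ordinal lt_kn).
Proof. by rewrite (tnth_nth x). Qed.

Lemma drop_alpha0E (A : Type) (x : A) (p : 11.-tuple A) (k : 'I_10) :
  drop_alpha0 p k = nth x p (bump 5 k).
Proof. by rewrite /drop_alpha0 (tnth_nth x) /= inordK. Qed.

Lemma coords_drop (k : 'I_10) : drop_alpha0 (coords R) k = of_poly (mpolyX _ (mnm1 k)).
Proof.
rewrite (drop_alpha0E 0).
have E : varf R k = of_poly (mpolyX _ (mnm1 k)) by rewrite /varf inord_val.
by rewrite -E; case: k {E} => [[|[|[|[|[|[|[|[|[|[|]]]]]]]]]] ?].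
Qed.

Lemma coords_normalized : normalized (coords R).
Proof. by []. Qed.

Lemma mpoly_closed (P : polys R -> Prop) :
  (forall c, P (mpolyC _ c)) -> (forall k, P (mpolyX _ (mnm1 k))) ->
  (forall p q, P p -> P q -> P (p + q)) -> (forall p q, P p -> P q -> P (p * q)) ->
  forall p, P p.
Proof.
move=> PC PX PD PM p.
have P0 : P 0 by rewrite -mpolyC0; apply: PC.
have P1 : P 1 by rewrite -mpolyC1; apply: PC.
rewrite [p]mpolyE; apply: (big_ind P P0 PD) => m _.
rewrite -mul_mpolyC; apply: (PM) => //.
rewrite mpolyXE_id; apply: (big_ind P P1 PM) => k _.
elim: (m k) => [|j IH]; first by rewrite expr0.
by rewrite exprS; apply: (PM).
Qed.

(** Only ten coordinates are variables; the value of alpha_0 is forced by the normalization of [q],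
    through sums and products of regular values. *)
Lemma regular_coords (K : fieldType) (phi : {rmorphism polys R -> K})
    (q : 11.-tuple K) :
  normalized q -> (forall k : 'I_10, phi (mpolyX _ (mnm1 k)) = drop_alpha0 q k) ->
  regular_at phi (coords R) q.
Proof.
move=> nq phiX.
(* [bump 5] skips position 5, where alpha_0 sits. *)
have rX (k : nat) : (k < 10)%N -> regular phi (coords R)`_(bump 5 k) q`_(bump 5 k).
  move=> k10; rewrite -(drop_alpha0E 0 _ (Ordinal k10)) -(drop_alpha0E 0 _ (Ordinal k10)).
  by rewrite coords_drop -phiX; apply: regular_tofrac.
move=> k k11; have [->|k5] := eqVneq k 5%N.
  rewrite coords_normalized nq.
  have r6 : regular phi (coords R)`_6 q`_6 := rX 5%N isT.
  have r7 : regular phi (coords R)`_7 q`_7 := rX 6%N isT.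
  have r8 : regular phi (coords R)`_8 q`_8 := rX 7%N isT.
  have r9 : regular phi (coords R)`_9 q`_9 := rX 8%N isT.
  have r10 : regular phi (coords R)`_10 q`_10 := rX 9%N isT.
  have r2 := regular_nat phi 2; have r1 := regular_nat phi 1.
  by do 4![apply: regularB; last exact: regularM]; apply: regularB.
have E : bump 5 (unbump 5 k) = k by apply: unbumpK.
by rewrite -E; apply: rX; move: k k5 k11 {E}; do 11?[case=> //].
Qed.

Lemma regular_subst T : normalized T -> regular_at (subst T) (coords R) T.
Proof. by move=> nT; apply: regular_coords => // k; apply: substX. Qed.

Lemma regular_meval (p : 11.-tuple C) :
  normalized p -> regular_at (meval (drop_alpha0 p)) (coords R) p.
Proof. by move=> np; apply: regular_coords => // k; rewrite /= mevalXU. Qed.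

(* No denominator vanishes here. *)
Definition base_point : 11.-tuple C := [tuple 2; 1; 3; 1; 1; 0; 1; 0; 0; 0; 0].

Lemma base_point_normalized : normalized base_point.
Proof. by rewrite /normalized /= !mulr0 !subr0 subrr. Qed.

Lemma denominator_base_point i : denominator i base_point != 0.
Proof.
case: i => [|[|[|[|[|[|i]]]]]]; rewrite /denominator /= ?oner_eq0 ?pnatr_eq0 //.
- by rewrite subr_eq0 -[1]/(1%:R) eqr_nat.
- by rewrite subr_eq0 eqr_nat.
- by rewrite mulf_eq0 !subr_eq0 -[1]/(1%:R) !eqr_nat.
Qed.

Lemma denominator_coords i : denominator i (coords R) != 0.
Proof.
apply: regular_neq0 (denominator_base_point i).
exact/regular_denominator/regular_meval/base_point_normalized.
Qed.

(** * Extension of an involutive substitution to an automorphism of the function field *)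

Section Involution.
Variable i : nat.
Let T : transformation R := generator i (coords R).

Let normT : normalized T.
Proof. exact/generator_normalized/coords_normalized. Qed.

Lemma denominator_T : denominator i T != 0.
Proof. exact/denominator_generator/denominator_coords. Qed.

Lemma regular_subst_T : regular_at (subst T) T (coords R).
Proof.
rewrite -[X in regular_at _ _ X](generatorK (denominator_coords i)).
by apply: regular_generator; [exact: denominator_T | exact: regular_subst].
Qed.

(** Substituting twice is the identity on coordinates, hence on all polynomials. It is stated with
    [regular] because nothing yet excludes that [subst T] kills the denominator of [subst T p]. *)
Lemma regular_subst_subst p : regular (subst T) (subst T p) (of_poly p).
Proof.
elim/mpoly_closed: p => [c|k|p q Hp Hq|p q Hp Hq].
- by rewrite substC -[X in regular _ _ X](substC T); apply: regular_tofrac.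
- rewrite substX -coords_drop !(drop_alpha0E 0); apply: regular_subst_T.
  by case: k => [[|[|[|[|[|[|[|[|[|[|]]]]]]]]]] ?].
- by rewrite !rmorphD; apply: regularD.
- by rewrite !rmorphM; apply: regularM.
Qed.

(** If [subst T p] vanishes, substituting once more gives it both the values 0 and [p]. *)
Lemma subst_inj p : subst T p = 0 -> p = 0.
Proof.
move=> p0; have := regular_subst_subst p; rewrite p0 => r0.
by apply/eqP; rewrite -tofrac_eq0 -/(of_poly p) (regular_uniq r0 (regular_nat _ 0)).
Qed.

Lemma regular_act f : regular (subst T) f (act T f).
Proof. exact: (regular_repr subst_inj). Qed.

(** [act T f] can be computed from any fraction for [f] whose denominator survives; the morphism
    laws and the involution follow from this freedom. *)
Lemma act_regular f u : regular (subst T) f u -> act T f = u.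
Proof. exact: regular_uniq (regular_act f). Qed.

Lemma act_zmod_morphism : zmod_morphism (act T).
Proof. by move=> f g; apply: act_regular; apply: regularB; apply: regular_act. Qed.

Lemma act_monoid_morphism : monoid_morphism (act T).
Proof.
split=> [|f g]; apply: act_regular; first exact: (regular_nat _ 1).
by apply: regularM; apply: regular_act.
Qed.

HB.instance Definition _ := GRing.isZmodMorphism.Build _ _ (act T) act_zmod_morphism.
HB.instance Definition _ := GRing.isMonoidMorphism.Build _ _ (act T) act_monoid_morphism.

Lemma act_of_poly p : act T (of_poly p) = subst T p.
Proof. exact/act_regular/regular_tofrac. Qed.

Lemma act_constf c : act T (constf c) = constf c.
Proof. by rewrite act_of_poly substC. Qed.

Lemma act_coords k : (k < 11)%N -> act T (coords R)`_k = T`_k.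
Proof. by move=> k11; apply: act_regular; apply: regular_subst. Qed.

Lemma actK : involutive (act T).
Proof.
move=> f; apply: act_regular.
have /= fE := fraction_repr f; rewrite [X in regular _ _ X]fE.
apply: regular_div; last exact: regular_subst_subst.
- by rewrite tofrac_eq0 denom_ratioP.
- exact: regular_subst_subst.
Qed.

Lemma acts_by_generator : acts_by T.
Proof.
split; last by move=> k; rewrite !(tnth_nth 0); apply: act_coords.
by exists (act T); split=> //; [apply: inv_bij actK | apply: act_constf].
Qed.

End Involution.

Lemma refl_generator (i : 'I_6) : refl_s R i = generator i (coords R).
Proof.
case: i => [[|[|[|[|[|[|//]]]]]] ?]; rewrite /refl_s (tnth_nth (coords R)) /=;
 by rewrite !(tnth_nth 0) !inordK.
Qed.

Lemma pi_generator : diag_pi R = generator 6 (coords R).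
Proof. by rewrite /diag_pi !(tnth_nth 0) !inordK. Qed.

End RationalFunctions.

(** * Relations between the generators *)

Fixpoint admissible (F : fieldType) (u : seq nat) (p : 11.-tuple F) : Prop :=
  if u is i :: u' then denominator i p != 0 /\ admissible u' (generator i p)
  else True.

(** Points are moved by the first letter first, while automorphisms apply the last letter first;
    substitution reverses composition, so the two conventions agree in [act_indices_coords]. *)
Definition transform (F : fieldType) (u : seq nat) (p : 11.-tuple F) :=
  foldl (fun q i => generator i q) p u.

Definition generic_relation (u v : seq nat) : Prop :=
  forall (F : fieldType) (p : 11.-tuple F),
  admissible u p -> admissible v p -> transform u p = transform v p.

Lemma tuple11_case (A : Type) (Q : 11.-tuple A -> Prop) :
  (forall x y z w t a0 a1 a2 a3 a4 a5,
     Q [tuple x; y; z; w; t; a0; a1; a2; a3; a4; a5]) ->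
  forall p, Q p.
Proof. by move=> H p; rewrite (tuple11_eta (tnth p ord0) p). Qed.

Lemma mulr_neq0_eq (F : fieldType) (a b c : F) :
  a != 0 -> b != 0 -> c = a * b -> c != 0.
Proof. by move=> a0 b0 ->; apply: mulf_neq0. Qed.

Ltac generic_point :=
  move=> F; apply: tuple11_case => x y z w t a0 a1 a2 a3 a4 a5;
  rewrite /transform /= /denominator /=.
Ltac tuple_eq :=
  apply: val_inj; rewrite /=; congr [:: _; _; _; _; _; _; _; _; _; _; _].

Lemma relation01 : generic_relation [:: 0; 1]%N [:: 1; 0]%N.
Proof. by generic_point => _ _; tuple_eq; ring. Qed.

Lemma relation03 : generic_relation [:: 0; 3]%N [:: 3; 0]%N.
Proof.
generic_point => [] [x1 [xz _]] _.
by tuple_eq; field; rewrite ?x1 ?xz.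
Qed.

Lemma relation04 : generic_relation [:: 0; 4]%N [:: 4; 0]%N.
Proof. by generic_point => _ _; tuple_eq; ring. Qed.

Lemma relation05 : generic_relation [:: 0; 5]%N [:: 5; 0]%N.
Proof. by generic_point => _ _; tuple_eq; ring. Qed.

Lemma relation13 : generic_relation [:: 1; 3]%N [:: 3; 1]%N.
Proof. by generic_point => _ _; tuple_eq; ring. Qed.

Lemma relation14 : generic_relation [:: 1; 4]%N [:: 4; 1]%N.
Proof. by generic_point => _ _; tuple_eq; ring. Qed.

Lemma relation15 : generic_relation [:: 1; 5]%N [:: 5; 1]%N.
Proof. by generic_point => _ _; tuple_eq; ring. Qed.

Lemma relation24 : generic_relation [:: 2; 4]%N [:: 4; 2]%N.
Proof. by generic_point => _ _; tuple_eq; ring. Qed.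

Lemma relation25 : generic_relation [:: 2; 5]%N [:: 5; 2]%N.
Proof. by generic_point => _ _; tuple_eq; ring. Qed.

Lemma relation35 : generic_relation [:: 3; 5]%N [:: 5; 3]%N.
Proof.
generic_point => [] [xz [z0 _]] _.
by tuple_eq; field; rewrite ?z0 ?xz.
Qed.

Lemma relation02 : generic_relation [:: 0; 2; 0]%N [:: 2; 0; 2]%N.
Proof.
generic_point => [] [x1 [d1 [d2 _]]] [y0 [e1 [e2 _]]].
(* Along the word 0, 2, 0 the successive denominators are cleared to [q1] and [q3], along 2, 0, 2 to
   [q2] and [q4]; [field] needs them nonzero. The other braid relations proceed alike. *)
have q1 : y * (x - 1) - a0 != 0 by apply: (mulr_neq0_eq d1 x1); field.
have q2 : x * y + a2 + -1 * y != 0 by apply: (mulr_neq0_eq e1 y0); field.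
have q3 : x * (y * (x - 1) - a0) + (a2 + a0) * (x - 1) + -1 * (y * (x - 1) - a0) != 0.
  by apply: (mulr_neq0_eq d2 q1); field; rewrite q1 x1.
have q4 : y * (x * y + a2 + -1 * y) - (a0 + a2) * y != 0.
  by apply: (mulr_neq0_eq e2 q2); field; rewrite q2 y0.
by tuple_eq; field; rewrite ?x1 ?y0 ?q1 ?q2 ?q3 ?q4.
Qed.

Lemma relation12 : generic_relation [:: 1; 2; 1]%N [:: 2; 1; 2]%N.
Proof.
by generic_point => [] [_ [y0 _]] _; tuple_eq; field.
Qed.

Lemma relation23 : generic_relation [:: 2; 3; 2]%N [:: 3; 2; 3]%N.
Proof.
generic_point => [] [y0 [d1 [d2 _]]] [xz [e1 [e2 _]]].
have q1 : x * y + a2 + - z * y != 0 by apply: (mulr_neq0_eq d1 y0); field.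
have q2 : y * (x - z) - a3 != 0 by apply: (mulr_neq0_eq e1 xz); field.
have q3 : y * (x * y + a2 + - z * y) - (a3 + a2) * y != 0.
  by apply: (mulr_neq0_eq d2 q1); field; rewrite q1 y0.
have q4 : x * (y * (x - z) - a3) + (a2 + a3) * (x - z) + - z * (y * (x - z) - a3) != 0.
  by apply: (mulr_neq0_eq e2 q2); field; rewrite q2 xz.
by tuple_eq; field; rewrite ?xz ?y0 ?q1 ?q2 ?q3 ?q4.
Qed.

Lemma relation34 : generic_relation [:: 3; 4; 3]%N [:: 4; 3; 4]%N.
Proof.
generic_point => [] [xz [d1 [d2 _]]] [w0 [e1 [e2 _]]].
have q1 : w * (x - z) + a3 != 0 by apply: (mulr_neq0_eq d1 xz); field.
have q2 : x * w - (z * w + a4) != 0 by apply: (mulr_neq0_eq e1 w0); field.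
have q3 : x * (w * (x - z) + a3) - (z * (w * (x - z) + a3) + (a4 + a3) * (x - z)) != 0.
  by apply: (mulr_neq0_eq d2 q1); field; rewrite q1 xz.
have q4 : w * (x * w - (z * w + a4)) + (a3 + a4) * w != 0.
  by apply: (mulr_neq0_eq e2 q2); field; rewrite q2 w0.
by tuple_eq; field; rewrite ?xz ?w0 ?q1 ?q2 ?q3 ?q4.
Qed.

Lemma relation45 : generic_relation [:: 4; 5; 4; 5]%N [:: 5; 4; 5; 4]%N.
Proof.
generic_point => [] [w0 [d1 [d2 [d3 _]]]] [z0 [e1 [e2 [e3 _]]]].
(* [q1] to [q3] clear the denominators along 4, 5, 4, 5 and [r1] to [r3] those along 5, 4, 5, 4;
   squares enter through the term t / z^2 of s_5. *)
have q1 : z * w + a4 != 0 by apply: (mulr_neq0_eq d1 w0); field.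
have q2 : (w * (z * w + a4) - 2 * (a5 + a4) * w) * (z * w + a4) + t * w ^+ 2 != 0.
  by apply: (mulr_neq0_eq d2 (expf_neq0 2 q1)); field; rewrite q1 w0.
have q3 : (z * w + a4) *
     ((w * (z * w + a4) - 2 * (a5 + a4) * w) * (z * w + a4) + t * w ^+ 2) +
     (- a4 + 2 * (a5 + a4)) * ((z * w + a4) * (z * w + a4)) * w != 0.
  by apply: (mulr_neq0_eq d3 (mulf_neq0 w0 q2)); field; rewrite q1 q2 w0.
have r1 : (w * z - 2 * a5) * z + t != 0.
  by apply: (mulr_neq0_eq e1 (expf_neq0 2 z0)); field.
have r2 : z * ((w * z - 2 * a5) * z + t) + (a4 + 2 * a5) * (z * z) != 0.
  by apply: (mulr_neq0_eq e2 r1); field; rewrite r1 z0.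
have r3 : (((w * z - 2 * a5) * z + t) *
       (z * ((w * z - 2 * a5) * z + t) + (a4 + 2 * a5) * (z * z)) +
       - (2 * (- a5 + (a4 + 2 * a5)) * ((w * z - 2 * a5) * z + t)) * (z * z)) *
      (z * ((w * z - 2 * a5) * z + t) + (a4 + 2 * a5) * (z * z)) +
      - t * ((w * z - 2 * a5) * z + t) ^+ 2 * (z * z) != 0.
  apply: (mulr_neq0_eq e3 (expf_neq0 2 (mulf_neq0 z0 r2))).
  by field; rewrite r1 r2 z0.
by tuple_eq; field; rewrite ?w0 ?z0 ?q1 ?q2 ?q3 ?r1 ?r2 ?r3.
Qed.

(** As [pi] inverts x - 1 and puts alpha_1 in the place of alpha_0, the following s_0 subtracts
    alpha_1 (x - 1) from the new y; this is the shift of alpha_2 by alpha_1 inside the formula of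
    [pi]. *)
Lemma relation60 : generic_relation [:: 6; 0]%N [:: 1; 6]%N.
Proof.
generic_point => [] [+ _] _; rewrite mulf_eq0 negb_or => /andP[x1 _].
tuple_eq; rewrite ?div_sub1 ?invrK //; ring.
Qed.

Lemma relation62 : generic_relation [:: 6; 2]%N [:: 2; 6]%N.
Proof.
generic_point => [] [+ [q1 _]] [y0 [q2 _]]; rewrite mulf_eq0 negb_or => /andP[x1 z1].
move: q1; rewrite mulf_eq0 negb_or => /andP[x1' q1].
have q3 : x * y + a2 + -1 * y != 0.
  by rewrite (_ : _ + _ = (x - 1) * y + a2) //; ring.
by tuple_eq; field; rewrite ?q1 ?q3 ?x1' ?x1 ?y0.
Qed.

Lemma relation63 : generic_relation [:: 6; 3]%N [:: 3; 6]%N.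
Proof.
generic_point => [] [+ [q1 _]] [xz [q2 _]]; rewrite mulf_eq0 negb_or => /andP[x1 z1].
(* This is the numerator of x / (x - 1) - z / (z - 1), the denominator of s_3 after [pi]. *)
have q3 : x * (z - 1) + - z * (x - 1) != 0.
  by rewrite (_ : _ + _ = - (x - z)) ?oppr_eq0 //; ring.
by tuple_eq; field; rewrite ?x1 ?z1 ?xz ?q3.
Qed.

Lemma relation64 : generic_relation [:: 6; 4]%N [:: 4; 6]%N.
Proof.
generic_point => [] [+ [q1 _]] [w0 [q2 _]]; rewrite mulf_eq0 negb_or => /andP[x1 z1].
move: q1; rewrite mulf_eq0 negb_or => /andP[z1' q1].
have q3 : z * w + a4 + -1 * w != 0.
  by rewrite (_ : _ + _ = (z - 1) * w + a4) //; ring.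
by tuple_eq; field; rewrite ?q1 ?q3 ?z1' ?z1 ?w0.
Qed.

Lemma relation65 : generic_relation [:: 6; 5]%N [:: 5; 6]%N.
Proof.
generic_point => [] [+ [q1 _]] [z0 [q2 _]]; rewrite mulf_eq0 negb_or => /andP[x1 z1].
by tuple_eq; field; rewrite ?z1 ?z0.
Qed.

(** For involutions the commutation and braid forms suffice: exchanging the two sides on one
    alternating run inside (s_i s_j)^m brings equal letters together, and everything cancels. *)
Lemma coxeter_relations (T : Type) (s : nat -> T -> T) :
  (forall i, involutive (s i)) ->
  (forall i j, (i, j) \in [:: (0, 1); (0, 3); (0, 4); (0, 5); (1, 3); (1, 4);
      (1, 5); (2, 4); (2, 5); (3, 5)]%N ->
    forall x, s i (s j x) = s j (s i x)) ->
  (forall i j, (i, j) \in [:: (0, 2); (1, 2); (2, 3); (3, 4)]%N ->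
    forall x, s i (s j (s i x)) = s j (s i (s j x))) ->
  (forall x, s 4 (s 5 (s 4 (s 5 x))) = s 5 (s 4 (s 5 (s 4 x)))) ->
  forall (i j : 'I_6) x,
    foldr s x (map val (flatten (nseq (coxeter_matrix i j) [:: i; j]))) = x.
Proof.
move=> sK comm braid braid4 i j x.
have C01 := comm 0%N 1%N isT; have C03 := comm 0%N 3%N isT.
have C04 := comm 0%N 4%N isT; have C05 := comm 0%N 5%N isT.
have C13 := comm 1%N 3%N isT; have C14 := comm 1%N 4%N isT.
have C15 := comm 1%N 5%N isT; have C24 := comm 2%N 4%N isT.
have C25 := comm 2%N 5%N isT; have C35 := comm 3%N 5%N isT.
have B02 := braid 0%N 2%N isT; have B12 := braid 1%N 2%N isT.
have B23 := braid 2%N 3%N isT; have B34 := braid 3%N 4%N isT.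
by case: i => [[|[|[|[|[|[|//]]]]]] ?]; case: j => [[|[|[|[|[|[|//]]]]]] ?];
  rewrite /= ?(C01, C03, C04, C05, C13, C14, C15, C24, C25, C35);
  rewrite ?(B02, B12, B23, B34, braid4) !sK.
Qed.

(** * Words of generators as automorphisms of the function field *)

Section Words.
Variable R : realType.
Local Notation coords := (coords R).

Definition act_indices (u : seq nat) (f : ratfun R) : ratfun R :=
  foldr (fun i g => act (generator i coords) g) f u.

Lemma act_indices_zmod u : zmod_morphism (act_indices u).
Proof. by elim: u => [|i u IH] f g //=; rewrite IH rmorphB. Qed.

Lemma act_indices_monoid u : monoid_morphism (act_indices u).
Proof.
elim: u => [|i u [IH1 IHM]] //=.
by split=> [|f g] /=; [rewrite IH1 rmorph1 | rewrite IHM rmorphM].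
Qed.

HB.instance Definition _ u :=
  GRing.isZmodMorphism.Build _ _ (act_indices u) (act_indices_zmod u).
HB.instance Definition _ u :=
  GRing.isMonoidMorphism.Build _ _ (act_indices u) (act_indices_monoid u).

Lemma act_indices_constf u c : act_indices u (constf c) = constf c.
Proof. by elim: u => //= i u ->; rewrite act_constf. Qed.

Lemma map_transform (F K : fieldType) (g : {rmorphism F -> K}) u p :
  map_tuple g (transform u p) = transform u (map_tuple g p).
Proof. by elim: u p => //= i u IH p; rewrite IH map_generator. Qed.

Lemma map_denominator (F K : fieldType) (g : {rmorphism F -> K}) i p :
  denominator i (map_tuple g p) = g (denominator i p).
Proof.
rewrite (tuple11_eta 0 p).
by case: i => [|[|[|[|[|[|i]]]]]]; rewrite /denominator /= ?(rmorphM, rmorphB, rmorph1).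
Qed.

Lemma act_coords_tuple i :
  map_tuple (act (generator i coords)) coords = generator i coords.
Proof.
apply: eq_from_tnth => k; rewrite tnth_map.
by have [_ ->] := acts_by_generator R i.
Qed.

(** A field morphism commutes with the rational formulas of [transform], so the image of the
    coordinates under an automorphism is found by letting it act on the arguments. *)
Lemma act_indices_coords u : map_tuple (act_indices u) coords = transform u coords.
Proof.
elim: u => [|i u IH] /=; first by apply: eq_from_tnth => k; rewrite tnth_map.
rewrite -[X in transform u X]act_coords_tuple -map_transform -IH.
by apply: eq_from_tnth => k; rewrite !tnth_map.
Qed.

(** The denominator met after a prefix [v] is the image of a nonzero function under the field
    morphism [act_indices v], hence nonzero. *)
Lemma admissible_coords u : admissible u coords.
Proof.
rewrite -[u]cat0s; suff H v : admissible u (transform v coords) by apply: (H [::]).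
elim: u v => //= i u IH v; split; last first.
  by have := IH (rcons v i); rewrite /transform -cats1 foldl_cat.
rewrite -act_indices_coords map_denominator fmorph_eq0; exact: denominator_coords.
Qed.

(** Both sides are field morphisms fixing the constants, so they are determined by the images of the
    coordinates. *)
Lemma eq_act_indices u v :
  transform u coords = transform v coords -> act_indices u =1 act_indices v.
Proof.
rewrite -!act_indices_coords => uv.
have E p : act_indices u (of_poly p) = act_indices v (of_poly p).
  elim/mpoly_closed: p => [c|k|p q Hp Hq|p q Hp Hq].
  - by rewrite !act_indices_constf.
  - rewrite -coords_drop /drop_alpha0.
    by have /(congr1 (fun p => tnth p (lift (inord 5) k))) := uv; rewrite !tnth_map.
  - by rewrite !rmorphD /= Hp Hq.
  - by rewrite !rmorphM /= Hp Hq.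
move=> f; have /= -> := fraction_repr f.
by rewrite !fmorph_div /= !E.
Qed.

Lemma relation_act u v : generic_relation u v -> act_indices u =1 act_indices v.
Proof. by move=> uv; apply/eq_act_indices/uv; apply: admissible_coords. Qed.

Lemma act_wordE (u : seq 'I_6) : act_word u =1 act_indices (map val u).
Proof. elim: u => // i u IH f; rewrite /act_word /= -/(act_word u f) IH.
by move: (refl_generator R i) => ->. Qed.

Lemma act_coxeter (i j : 'I_6) :
  act_word (flatten (nseq (coxeter_matrix i j) [:: i; j])) =1 (@id (ratfun R)).
Proof.
move=> f; rewrite act_wordE.
apply: (coxeter_relations (s := fun k => act (generator k coords)));
  first by move=> k; apply: actK.
- move=> k l; rewrite !inE !xpair_eqE.
  do 9?[case/orP]; move=> /andP[/eqP-> /eqP->].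
  + exact: (relation_act relation01).
  + exact: (relation_act relation03).
  + exact: (relation_act relation04).
  + exact: (relation_act relation05).
  + exact: (relation_act relation13).
  + exact: (relation_act relation14).
  + exact: (relation_act relation15).
  + exact: (relation_act relation24).
  + exact: (relation_act relation25).
  + exact: (relation_act relation35).
- move=> k l; rewrite !inE !xpair_eqE.
  do 3?[case/orP]; move=> /andP[/eqP-> /eqP->].
  + exact: (relation_act relation02).
  + exact: (relation_act relation12).
  + exact: (relation_act relation23).
  + exact: (relation_act relation34).
- exact: (relation_act relation45).
Qed.

Lemma act_word_cat (u v : seq 'I_6) (f : ratfun R) :
  act_word (u ++ v) f = act_word u (act_word v f).
Proof. exact: foldr_cat. Qed.

Lemma coxeter_eq_act u v : coxeter_eq u v -> @act_word R u =1 act_word v.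
Proof.
elim=> // [{}u {}v i j f | {}u {}v _ uv f | {}u {}v w _ uv _ vw f].
- by rewrite !act_word_cat act_coxeter.
- by rewrite uv.
- by rewrite uv vw.
Qed.

Lemma act_pi f : act (diag_pi R) (act (diag_pi R) f) = f.
Proof. by rewrite pi_generator actK. Qed.

Lemma act_pi_refl0 f :
  act (diag_pi R) (act (refl_s R (inord 0)) f)
  = act (refl_s R (inord 1)) (act (diag_pi R) f).
Proof.
have := pi_generator R.
have := refl_generator R (inord 0); have := refl_generator R (inord 1).
have [-> ->] : (inord 0 : 'I_6) = 0%N :> nat /\ (inord 1 : 'I_6) = 1%N :> nat.
  by rewrite !inordK.
move: (diag_pi R) (refl_s R _) (refl_s R _) => P S0 S1 -> -> ->.
exact: (relation_act relation60).
Qed.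

Lemma act_pi_refl (i : 'I_6) f : (2 <= i)%N ->
  act (diag_pi R) (act (refl_s R i) f) = act (refl_s R i) (act (diag_pi R) f).
Proof.
have := pi_generator R; have := refl_generator R i.
move: (diag_pi R) (refl_s R _) => P S -> -> i2.
have : nat_of_ord i \in iota 2 4 by rewrite mem_iota i2 ltn_ord.
move: (nat_of_ord i) => {i2} k; rewrite !inE => /or4P[] /eqP ->.
- exact: (relation_act relation62).
- exact: (relation_act relation63).
- exact: (relation_act relation64).
- exact: (relation_act relation65).
Qed.

End Words.

(** * Reduced words and faithfulness *)

Section CoxeterWords.
Implicit Types (u v w : seq 'I_6) (s t : 'I_6).

Lemma coxeter_eq_cat u u' v v' :
  coxeter_eq u u' -> coxeter_eq v v' -> coxeter_eq (u ++ v) (u' ++ v').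
Proof.
have catl a b c : coxeter_eq a b -> coxeter_eq (c ++ a) (c ++ b).
  elim=> {a b} [a b i j|a|a b _|a b d _ ab _]; last exact: Coxeter_trans.
  - by rewrite (catA c a b) (catA c); apply: Coxeter_rel.
  - exact: Coxeter_refl.
  - exact: Coxeter_sym.
have catr a b c : coxeter_eq a b -> coxeter_eq (a ++ c) (b ++ c).
  elim=> {a b} [a b i j|a|a b _|a b d _ ab _]; last exact: Coxeter_trans.
  - by rewrite -!catA; apply: Coxeter_rel.
  - exact: Coxeter_refl.
  - exact: Coxeter_sym.
by move=> uu' vv'; apply: Coxeter_trans (catl _ _ _ vv'); apply: catr.
Qed.

(** Every relator has even length: this is the sign character of the Coxeter group. *)
Lemma coxeter_eq_odd u v : coxeter_eq u v -> odd (size u) = odd (size v).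
Proof.
elim=> {u v} [u v i j|//|u v _ -> //|u v w _ -> _ -> //].
rewrite !size_cat size_flatten /shape map_nseq sumn_nseq.
by rewrite mul2n !oddD odd_double.
Qed.

Lemma coxeter_eq_rel i j : coxeter_eq (flatten (nseq (coxeter_matrix i j) [:: i; j])) [::].
Proof. by have := Coxeter_rel [::] [::] i j; rewrite cats0. Qed.

Lemma coxeter_eq_square s : coxeter_eq [:: s; s] [::].
Proof. by have := coxeter_eq_rel s s; rewrite /coxeter_matrix eqxx. Qed.

(** The generators are involutions, so reversing a word inverts it. *)
Lemma coxeter_eq_rev u : coxeter_eq (u ++ rev u) [::].
Proof.
elim: u => [|s u IH]; first exact: Coxeter_refl.
rewrite rev_cons -cats1 catA /= -cat1s.
apply: Coxeter_trans (coxeter_eq_square s).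
apply: (@coxeter_eq_cat [:: s] [:: s] _ [:: s]); first exact: Coxeter_refl.
rewrite -[X in coxeter_eq _ X]cat0s; apply: coxeter_eq_cat IH _; exact: Coxeter_refl.
Qed.

Lemma coxeter_eq_move u v : coxeter_eq (u ++ v) [::] -> coxeter_eq u (rev v).
Proof.
move=> uv; apply: (@Coxeter_trans _ (u ++ v ++ rev v)).
  rewrite -[X in coxeter_eq X]cats0; apply: coxeter_eq_cat (Coxeter_refl _) _.
  exact/Coxeter_sym/coxeter_eq_rev.
rewrite catA -[X in coxeter_eq _ X]cat0s.
exact: coxeter_eq_cat uv (Coxeter_refl _).
Qed.

Definition reduced u := forall v, coxeter_eq u v -> (size u <= size v)%N.

Lemma reduced_factor u v w : reduced (u ++ v ++ w) -> reduced v.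
Proof.
move=> red v' vv'.
have /red : coxeter_eq (u ++ v ++ w) (u ++ v' ++ w).
  by do 2?[apply: coxeter_eq_cat]; try exact: Coxeter_refl.
by rewrite !size_cat leq_add2l leq_add2r.
Qed.

Lemma reduced_prefix u v : reduced (u ++ v) -> reduced u.
Proof. exact: (@reduced_factor [::]). Qed.

Lemma reduced_suffix u v : reduced (u ++ v) -> reduced v.
Proof. by rewrite -[v in X in X -> _]cats0; apply: reduced_factor. Qed.

Lemma reduced_exists u : exists2 v, coxeter_eq u v & reduced v.
Proof.
have [n] := ubnP (size u); elim: n u => // n IH u; rewrite ltnS => un.
have [red|/existsNP[v /not_implyP[uv /negP]]] := boolp.EM (reduced u).
  by exists u => //; apply: Coxeter_refl.
rewrite -ltnNge => vu; have [w vw red] := IH v (leq_trans vu un).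
by exists w => //; apply: Coxeter_trans vw.
Qed.

Lemma not_reduced_square s : ~ reduced [:: s; s].
Proof. by move=> /(_ _ (coxeter_eq_square s)). Qed.

Lemma min_prop (Q : nat -> Prop) :
  (exists n, Q n) -> exists2 n, Q n & forall k, Q k -> (n <= k)%N.
Proof.
move=> [n Qn]; have [|k /boolp.asboolP Qk kmin] := @ex_minnP (fun n => `[< Q n >]).
  by exists n; apply/boolp.asboolP.
by exists k => // j /boolp.asboolP; apply: kmin.
Qed.

(* [bond i k] is the coefficient of [alpha_i] in [s_i (alpha_k)] *)
Definition bond (i k : 'I_6) : nat :=
  nth 0%N (nth [::] [:: [:: 0; 0; 1; 0; 0; 0]; [:: 0; 0; 1; 0; 0; 0];
    [:: 1; 1; 0; 1; 0; 0]; [:: 0; 0; 1; 0; 1; 0];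
    [:: 0; 0; 0; 1; 0; 1]; [:: 0; 0; 0; 0; 2; 0]] i) k.

(** The product of the two bonds is 4 cos^2(pi / m), where m is the order of s t. *)
Lemma coxeter_matrixP s t : s != t ->
  [\/ coxeter_matrix s t = 2,
      coxeter_matrix s t = 3 /\ bond s t * bond t s = 1 |
      coxeter_matrix s t = 4 /\ bond s t * bond t s = 2]%N.
Proof.
case: s => [[|[|[|[|[|[|//]]]]]] ?]; case: t => [[|[|[|[|[|[|//]]]]]] ?] //= _;
  by [constructor 1 | constructor 2 | constructor 3].
Qed.

Lemma coxeter_matrixC s t : coxeter_matrix s t = coxeter_matrix t s.
Proof. by rewrite /coxeter_matrix minnC maxnC eq_sym. Qed.

(* [d] alternates, ends with [t] and is shorter than the order of [s t]. *)
Lemma dihedral_reduced s t d : s != t -> all (mem [:: s; t]) d ->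
  reduced (d ++ [:: s]) ->
  [\/ d = [::], d = [:: t],
      d = [:: s; t] /\ bond s t * bond t s = 1
    | (d = [:: s; t] \/ d = [:: t; s; t]) /\ bond s t * bond t s = 2]%N.
Proof.
(* The word is peeled from the right: before the final [s] the letters must alternate, since an
   equal pair is not reduced. *)
move=> st; elim/last_ind: d => [|d x _]; first by constructor 1.
rewrite all_rcons !inE -cats1 -(catA d) => /andP[/orP[] /eqP-> std] red.
  by have := not_reduced_square (reduced_suffix red).
elim/last_ind: d std red => [|d y _]; first by constructor 2.
rewrite all_rcons !inE -cats1 -(catA d) /= => /andP[/orP[] /eqP-> std] red; last first.
  by have := not_reduced_square (reduced_factor (v := [:: t; t]) red).
have := coxeter_eq_rel s t; have := coxeter_eq_rel t s; rewrite -(coxeter_matrixC s t).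
have [E|[E b]|[E b]] := coxeter_matrixP st; rewrite {}E /= => Ets Est.
(* In each case the relation of order m equates the alternating word of length m + 1 with one of
   length m - 1, so the longer one is not reduced. *)
- have /(_ _ (coxeter_eq_move (u := [:: s; t; s]) (v := [:: t]) Est)) :=
    reduced_suffix red.
  by [].
- elim/last_ind: d std red => [|d z _]; first by constructor 3.
  rewrite all_rcons !inE -cats1 -(catA d) /= => /andP[/orP[] /eqP-> std] red.
    by have := not_reduced_square (reduced_factor (v := [:: s; s]) red).
  have /(_ _ (coxeter_eq_move (u := [:: t; s; t; s]) (v := [:: t; s]) Ets)) :=
    reduced_suffix red.
  by [].
- elim/last_ind: d std red => [|d z _]; first by constructor 4; split=> //; left.
  rewrite all_rcons !inE -cats1 -(catA d) /= => /andP[/orP[] /eqP-> std] red.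
    by have := not_reduced_square (reduced_factor (v := [:: s; s]) red).
  elim/last_ind: d std red => [|d y' _]; first by constructor 4; split=> //; right.
  rewrite all_rcons !inE -cats1 -(catA d) /= => /andP[/orP[] /eqP-> std] red; last first.
    by have := not_reduced_square (reduced_factor (v := [:: t; t]) red).
  have /(_ _ (coxeter_eq_move (u := [:: s; t; s; t; s]) (v := [:: t; s; t]) Est)) :=
    reduced_suffix red.
  by [].
Qed.

End CoxeterWords.

(** The parameters transform as simple roots under simple reflections; the offset 5 passes over x,
    y, z, w, t. *)
Lemma generator_param (F : fieldType) (p : 11.-tuple F) (i k : 'I_6) :
  (generator i p)`_(5 + k) =
  if i == k then - p`_(5 + i) else p`_(5 + k) + p`_(5 + i) *+ bond i k.
Proof.
rewrite (tuple11_eta 0 p).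
case: i => [[|[|[|[|[|[|//]]]]]] ?]; case: k => [[|[|[|[|[|[|//]]]]]] ?];
  by rewrite /= ?mulr0n ?addr0 // mulr_natl.
Qed.

(** * Positivity of roots on the alcove, and faithfulness *)

Section Faithful.
Variable R : realType.
Local Notation C := R[i].
Implicit Types (u v w : seq 'I_6) (s t : 'I_6) (f g : ratfun R).

Definition alpha (k : 'I_6) : ratfun R := (coords R)`_(5 + k).

(* A point of the fundamental alcove: all simple roots take the value 1/10. *)
Definition alcove_point : 11.-tuple C :=
  let c := 10^-1 in [tuple 0; 0; 0; 0; 0; c; c; c; c; c; c].

(** The coefficients 1, 1, 2, 2, 2, 2 of the linear relation add up to 10. *)
Lemma alcove_point_normalized : normalized alcove_point.
Proof. by rewrite /normalized /=; field. Qed.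

(** In the partial order of [R[i]], [0 <= r] includes that [r] is real. *)
Definition nonneg f : Prop :=
  exists2 r, regular (meval (drop_alpha0 alcove_point)) f r & 0 <= r.

Lemma regular_alpha k :
  regular (meval (drop_alpha0 alcove_point)) (alpha k) 10^-1.
Proof.
have -> : 10^-1 = alcove_point`_(5 + k).
  by case: k => [[|[|[|[|[|[|//]]]]]] ?].
by apply: (regular_meval alcove_point_normalized); rewrite -[11%N]/(5 + 6)%N ltn_add2l.
Qed.

Lemma nonneg_alpha k : nonneg (alpha k).
Proof. by exists 10^-1; [apply: regular_alpha | rewrite invr_ge0 ler0n]. Qed.

Lemma nonneg_comb f g a b : nonneg f -> nonneg g -> nonneg (f *+ a + g *+ b).
Proof.
have nnM h n : nonneg h -> nonneg (h *+ n).
  move=> [r hr r0]; exists (r *+ n); last by rewrite mulrn_wge0.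
  by rewrite -mulr_natl -[r *+ n]mulr_natl; apply: regularM (regular_nat _ n) hr.
move=> /(nnM _ a)[r fr r0] /(nnM _ b)[q gq q0].
by exists (r + q); [apply: regularD | apply: addr_ge0].
Qed.

Lemma act_refl_alpha i k :
  act (refl_s R i) (alpha k) =
  if i == k then - alpha i else alpha k + alpha i *+ bond i k.
Proof.
rewrite -(generator_param (coords R)); have := refl_generator R i.
move: (refl_s R i) => S ->; apply: act_coords.
by rewrite -[11%N]/(5 + 6)%N ltn_add2l.
Qed.

Lemma act_word_zmod u : zmod_morphism (@act_word R u).
Proof. by move=> f g; rewrite !act_wordE raddfB. Qed.

HB.instance Definition _ u :=
  GRing.isZmodMorphism.Build _ _ (@act_word R u) (act_word_zmod u).

Lemma act_word_rcons u s f : act_word (rcons u s) f = act_word u (act (refl_s R s) f).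
Proof. by rewrite -cats1 act_word_cat. Qed.

(** This is positivity in a root system of rank two: [dihedral_reduced] leaves only a few words, and
    each gives natural coefficients [a] and [b]. *)
Lemma act_dihedral s t d : s != t -> all (mem [:: s; t]) d ->
  reduced (d ++ [:: s]) ->
  exists a b, act_word d (alpha s) = alpha s *+ a + alpha t *+ b.
Proof.
move=> st std red.
have actD k f g : act (refl_s R k) (f + g) = act (refl_s R k) f + act (refl_s R k) g.
  by move: (refl_generator R k) => ->; rewrite rmorphD.
have actMn k f n : act (refl_s R k) (f *+ n) = act (refl_s R k) f *+ n.
  by move: (refl_generator R k) => ->; rewrite rmorphMn.
have ss : act (refl_s R s) (alpha s) = - alpha s by rewrite act_refl_alpha eqxx.
have tt : act (refl_s R t) (alpha t) = - alpha t by rewrite act_refl_alpha eqxx.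
have Est : act (refl_s R s) (alpha t) = alpha t + alpha s *+ bond s t.
  by rewrite act_refl_alpha (negPf st).
have Ets : act (refl_s R t) (alpha s) = alpha s + alpha t *+ bond t s.
  by rewrite act_refl_alpha eq_sym (negPf st).
(* The coefficient of alpha_s is the product of the bonds minus 1, which is 0 or 1 for the words
   that remain. *)
have E2 : act_word [:: s; t] (alpha s) =
    alpha s *+ (bond s t * bond t s) - alpha s + alpha t *+ bond t s.
  rewrite /= Ets actD actMn ss Est mulrnDl mulrnA.
  by rewrite [_ *+ _ + _ *+ _ *+ _]addrC addrA [- _ + _]addrC.
have [->|->|[-> b]|[[->|->] b]] := dihedral_reduced st std red.
- by exists 1%N, 0%N; rewrite addr0.
- by exists 1%N, (bond t s); rewrite /= Ets.
- by exists 0%N, (bond t s); rewrite E2 b subrr.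
- by exists 1%N, (bond t s); rewrite E2 b mulr2n addrK.
(* When the bonds have product 2, t s t fixes alpha_s. *)
- exists 1%N, 0%N; rewrite -cat1s act_word_cat E2 b mulr2n addrK /=.
  by rewrite actD actMn Ets tt mulNrn addrK addr0.
Qed.

(* A reduced word [u] such that [u s] is reduced keeps the alcove on the
   positive side of the wall of [s] (Tits). *)
Lemma reduced_nonneg u s :
  reduced u -> reduced (rcons u s) -> nonneg (act_word u (alpha s)).
Proof.
have [n] := ubnP (size u); elim: n u s => // n IH u s; rewrite ltnS => un.
case/lastP E: u => [|u' t] red reds; first exact: nonneg_alpha.
rewrite -E in red reds *.
have st : s != t.
  apply/eqP => st; move: reds; rewrite E st -!cats1 -catA => /reduced_suffix.
  exact: not_reduced_square.
(* [u] is split so that its right factor in the group of [s, t] is longest. *)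
pose Q k := exists v d, [/\ coxeter_eq u (v ++ d), (size v + size d = size u)%N,
  all (mem [:: s; t]) d & size v = k].
(* Splitting off the last letter [t] is one such factorization; it makes the minimal [v] strictly
   shorter than [u]. *)
have Qu' : Q (size u').
  exists u', [:: t]; split; rewrite //= ?inE ?eqxx ?orbT //.
    by rewrite cats1 E; apply: Coxeter_refl.
  by rewrite E size_rcons addn1.
have [k [v [d [uvd szvd std vk]]] kmin] := min_prop (ex_intro _ _ Qu').
have vu : (size v < size u)%N.
  by rewrite vk E size_rcons ltnS; apply: kmin.
have redv : reduced v.
  move=> v' vv'; rewrite -(leq_add2r (size d)) szvd -size_cat; apply: red.
  by apply: Coxeter_trans uvd _; apply: coxeter_eq_cat vv' (Coxeter_refl _).
have redd : reduced (d ++ [:: s]).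
  move=> e de; rewrite -(leq_add2l (size v)) size_cat addnA szvd /= -size_cat.
  rewrite addn1 -(size_rcons u s); apply: reds; rewrite -cats1.
  apply: Coxeter_trans (coxeter_eq_cat uvd (Coxeter_refl _)) _.
  by rewrite -catA; apply: coxeter_eq_cat (Coxeter_refl _) de.
(* If [v r] were not reduced, parity would make it equal to a word [e] shorter than [v]; then [e]
   followed by [r :: d] is again a factorization of [u], against the minimality of [v]. *)
have redvr r : r \in [:: s; t] -> reduced (rcons v r).
  move=> rst e ve; rewrite size_rcons; have := coxeter_eq_odd ve.
  rewrite size_rcons /=; case: (ltngtP (size v) (size e)) => [//| ev _|->];
    last by case: odd.
  have ver : coxeter_eq u (e ++ r :: d).
    apply: Coxeter_trans uvd _; rewrite -cat_rcons -cats1.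
    apply: coxeter_eq_cat _ (Coxeter_refl _).
    apply: (@Coxeter_trans _ (v ++ [:: r; r])).
      rewrite -[X in coxeter_eq X]cats0; apply: coxeter_eq_cat (Coxeter_refl _) _.
      exact/Coxeter_sym/coxeter_eq_square.
    have -> : v ++ [:: r; r] = rcons v r ++ [:: r] by rewrite -cats1 -catA.
    exact: coxeter_eq_cat ve (Coxeter_refl _).
  suff /kmin : Q (size e) by rewrite -vk leqNgt ev.
  exists e, (r :: d); split=> //; last by rewrite /= rst.
  apply/eqP; rewrite eqn_leq -{2}size_cat (red _ ver) andbT.
  by rewrite /= addnS -addSn -szvd leq_add2r.
have [a [b dE]] := act_dihedral st std redd.
have -> : act_word u (alpha s) = act_word v (alpha s *+ a + alpha t *+ b).
  by rewrite (coxeter_eq_act uvd) act_word_cat dE.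
(* The induction hypothesis applies to [v] with each of the letters [s] and [t]. *)
rewrite raddfD !raddfMn; have vn := leq_trans vu un.
apply: nonneg_comb; apply: IH => //; apply: redvr; by rewrite !inE eqxx ?orbT.
Qed.

(** Let a reduced word for u v^-1 act trivially. If it ends with a letter s, the word before s sends
    alpha_s to - alpha_s, whose value -1/10 at the alcove point contradicts [reduced_nonneg]; so it
    is empty. *)
Lemma coxeter_faithful u v : @act_word R u =1 act_word v -> coxeter_eq u v.
Proof.
move=> uv.
have [w uw red] := reduced_exists (u ++ rev v).
have wid f : act_word w f = f.
  rewrite -(coxeter_eq_act uw) act_word_cat uv -act_word_cat.
  by rewrite (coxeter_eq_act (coxeter_eq_rev v)).
case/lastP: w red uw wid => [_ uw _|w s red _ wid].
  by rewrite -[v]revK; apply: coxeter_eq_move.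
have [] := reduced_nonneg (u := w) (s := s) _ red.
  by move: red; rewrite -cats1; apply: reduced_prefix.
move=> r rw r0; have := wid (alpha s).
rewrite act_word_rcons act_refl_alpha eqxx raddfN => E.
have := regular_uniq (regularN rw) (eq_ind_r (fun f => regular _ f _) (regular_alpha s) E).
move=> rE; suff : (0 : C) < 0 by rewrite ltxx.
rewrite {2}(_ : 0 = - r + r); last by rewrite addNr.
by rewrite rE ltr_wpDr // invr_gt0 ltr0n.
Qed.

End Faithful.

(** * Transformation of the differential system *)

Section Derivatives.
Local Open Scope classical_set_scope.
Variable C : numFieldType.
Implicit Types (f g : C^o -> C^o) (s d e c : C^o).

Local Notation is_der s f d := (is_derive (s : C^o) 1 (f : C^o -> C^o) (d : C^o)).

Lemma is_der_cst c s : is_der s (fun=> c) 0.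
Proof. exact: is_derive_cst. Qed.

Lemma is_derD s f g d e : is_der s f d -> is_der s g e -> is_der s (fun u => f u + g u) (d + e).
Proof. exact: is_deriveD. Qed.

Lemma is_derN s f d : is_der s f d -> is_der s (fun u => - f u) (- d).
Proof. exact: is_deriveN. Qed.

Lemma is_derB s f g d e : is_der s f d -> is_der s g e -> is_der s (fun u => f u - g u) (d - e).
Proof. exact: is_deriveB. Qed.

Lemma is_derM s f g d e : is_der s f d -> is_der s g e ->
  is_der s (fun u => f u * g u) (d * g s + f s * e).
Proof.
move=> fd ge; apply: is_derive_eq (is_deriveM fd ge) _.
by rewrite addrC; congr (_ + _); apply: mulrC.
Qed.

Lemma is_derX2 s f d : is_der s f d -> is_der s (fun u => f u ^+ 2) (2 * f s * d).
Proof.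
move=> fd; apply: is_derive_eq (is_derM fd fd) _.
have E (a b : C) : b * a + a * b = 2 * a * b by ring.
exact: E.
Qed.

Lemma is_derV s f d : is_der s f d -> f s != 0 ->
  is_der s (fun u => (f u)^-1) (- d / f s ^+ 2).
Proof.
move=> [fd fE] f0; apply: DeriveDef; first exact: derivableV.
by rewrite deriveV // fE mulNr mulrC -mulNr.
Qed.

Lemma is_der_div s f g d e : is_der s f d -> is_der s g e -> g s != 0 ->
  is_der s (fun u => f u / g u) (d / g s + f s * (- e / g s ^+ 2)).
Proof. by move=> fd ge g0; exact: (is_derM fd (is_derV ge g0)). Qed.

(** The difference quotient of u |-> f (- u) at s with increment h is minus that of f at - s with
    increment - h. *)
Lemma is_der_opp_arg s f d : is_der (- s) f d -> is_der s (fun u => f (- u)) (- d).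
Proof.
move=> [fd fE].
pose q (h : C) := h^-1 *: ((f \o shift (- s)) (h *: (1 : C^o)) - f (- s)).
have qd : q @ 0^' --> d by rewrite -fE.
have Nqd : (fun h => - q (- h)) @ 0^' --> - d.
  apply: cvgN; apply: cvg_comp qd.
  (* Negation preserves the punctured neighbourhoods of 0. *)
  move=> A A0; have : (- (0 : C))^' A by rewrite oppr0.
  rewrite dnbhsN => -[B B0 <-].
  by apply: filterS B0 => h Bh; exists h.
have E : (fun h : C => h^-1 *: (((fun u => f (- u)) \o shift s) (h *: (1 : C^o)) - f (- s)))
    = (fun h => - q (- h)).
  apply/funext => h; rewrite /q /= invrN scaleNr opprK.
  by rewrite scaleNr opprD.
apply: DeriveDef; first by apply/cvg_ex; exists (- d); rewrite E.
by rewrite /derive E; apply: cvg_lim.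
Qed.

End Derivatives.

(* [vector_field], over an arbitrary field *)
Definition velocity (F : fieldType) (p : 11.-tuple F) : 4.-tuple F :=
  let x := p`_0 in let y := p`_1 in let z := p`_2 in let w := p`_3 in
  let t := p`_4 in let a1 := p`_6 in let a2 := p`_7 in let a3 := p`_8 in
  let a4 := p`_9 in let a5 := p`_10 in
  [tuple
    - ((2 * x ^+ 3 * y - 2 * x ^+ 2 * y + (a1 + 2 * a2) * x ^+ 2
        + (t - 1 + 2 * a3 + 2 * a4 + 2 * a5) * x - t) / t)
    - 2 * (x - 1) * z * (z * w + a4) / t;

    (3 * x ^+ 2 * y ^+ 2 - 2 * x * y ^+ 2 + 2 * (a1 + 2 * a2) * x * y
        + (t - 1 + 2 * a3 + 2 * a4 + 2 * a5) * y + a2 * (a1 + a2)) / t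
    + 2 * y * z * (z * w + a4) / t;

    - ((2 * z ^+ 3 * w - 2 * z ^+ 2 * w + (a1 + 2 * a2 + a3 + 2 * a4) * z ^+ 2
        + (t - 1 + 2 * a5) * z - t) / t)
    - 2 * (x - 1) * y * z ^+ 2 / t;

    (3 * z ^+ 2 * w ^+ 2 - 2 * z * w ^+ 2
        + 2 * (a1 + 2 * a2 + a3 + 2 * a4) * z * w + (t - 1 + 2 * a5) * w) / t
    + (a4 * (a1 + 2 * a2 + a3 + a4) + 2 * (x - 1) * y * (2 * z * w + a4)) / t].

Section Velocity.
Variable C : numFieldType.
Local Notation is_der s f d := (is_derive (s : C^o) 1 (f : C^o -> C^o) (d : C^o)).

(** The new time is this sign times t: s_5 and [pi] reverse time. Being its own inverse, it also
    recovers t from the new time. *)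
Definition time_sign (i : nat) : C := if (i < 5)%N then 1 else - 1.

Lemma is_der_time_sign i (f : C^o -> C^o) (s d : C) :
  is_der (time_sign i * s) f d ->
  is_der s (fun u => f (time_sign i * u)) (time_sign i * d).
Proof.
rewrite /time_sign; case: ifP => _.
  rewrite !mul1r => fd; rewrite (_ : (fun u => _) = f) //.
  by apply/funext => u; rewrite mul1r.
rewrite !mulN1r => /is_der_opp_arg fd; rewrite (_ : (fun u => _) = fun u => f (- u)) //.
by apply/funext => u; rewrite mulN1r.
Qed.

(** The curves are a solution reparametrized by the new time s, with t = [time_sign i * s]; hence
    the factor [time_sign i] in their derivatives. The quotient and product rules then leave a
    rational identity in each component. *)
Lemma generator_velocity i (x y z w : C^o -> C^o) (a0 a1 a2 a3 a4 a5 s : C)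
    (vx vy vz vw : C) :
  let P u := [tuple x u; y u; z u; w u; time_sign i * u; a0; a1; a2; a3; a4; a5] in
  normalized (P s) -> s != 0 -> denominator i (P s) != 0 ->
  is_der s x vx -> is_der s y vy -> is_der s z vz -> is_der s w vw ->
  [:: vx; vy; vz; vw] = [seq time_sign i * v | v <- velocity (P s)] ->
  forall k, (k < 4)%N ->
    is_der s (fun u => (generator i (P u))`_k) (velocity (generator i (P s)))`_k.
Proof.
move=> P nP s0 d0 dx dy dz dw.
have du : is_der s (fun u => u) 1 by apply: is_derive_id.
rewrite /P /normalized /= in nP *; subst a0.
rewrite /P /denominator /= in d0 *; set a0 := 1 - a1 - _ - _ - _ - _.
case: i {P} d0 => [|[|[|[|[|[|i]]]]]]; rewrite /time_sign /= => d0 [Ex Ey Ez Ew].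
- have H := is_derB dy (is_der_div (is_der_cst a0 s) (is_derB dx (is_der_cst 1 s)) d0).
  do 4?[case=> [_|]] => //=.
  + by apply: is_derive_eq dx _; rewrite Ex /a0; field; rewrite ?d0 ?s0.
  + by apply: is_derive_eq H _; rewrite Ex Ey /a0; field; rewrite ?d0 ?s0.
  + by apply: is_derive_eq dz _; rewrite Ez /a0; field; rewrite ?d0 ?s0.
  + by apply: is_derive_eq dw _; rewrite Ew /a0; field; rewrite ?d0 ?s0.
- do 4?[case=> [_|]] => //=.
  + by apply: is_derive_eq dx _; rewrite Ex; field; rewrite ?d0 ?s0.
  + by apply: is_derive_eq dy _; rewrite Ey; field; rewrite ?d0 ?s0.
  + by apply: is_derive_eq dz _; rewrite Ez; field; rewrite ?d0 ?s0.
  + by apply: is_derive_eq dw _; rewrite Ew; field; rewrite ?d0 ?s0.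
- have H := is_derD dx (is_der_div (is_der_cst a2 s) dy d0).
  do 4?[case=> [_|]] => //=.
  + by apply: is_derive_eq H _; rewrite Ex Ey; field; rewrite ?d0 ?s0.
  + by apply: is_derive_eq dy _; rewrite Ey; field; rewrite ?d0 ?s0.
  + by apply: is_derive_eq dz _; rewrite Ez; field; rewrite ?d0 ?s0.
  + by apply: is_derive_eq dw _; rewrite Ew; field; rewrite ?d0 ?s0.
- have H := is_der_div (is_der_cst a3 s) (is_derB dx dz) d0.
  have Hy := is_derB dy H; have Hw := is_derD dw H.
  do 4?[case=> [_|]] => //=.
  + by apply: is_derive_eq dx _; rewrite Ex; field; rewrite ?d0 ?s0.
  + by apply: is_derive_eq Hy _; rewrite Ex Ey Ez; field; rewrite ?d0 ?s0.
  + by apply: is_derive_eq dz _; rewrite Ez; field; rewrite ?d0 ?s0.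
  + by apply: is_derive_eq Hw _; rewrite Ex Ez Ew; field; rewrite ?d0 ?s0.
- have H := is_derD dz (is_der_div (is_der_cst a4 s) dw d0).
  do 4?[case=> [_|]] => //=.
  + by apply: is_derive_eq dx _; rewrite Ex; field; rewrite ?d0 ?s0.
  + by apply: is_derive_eq dy _; rewrite Ey; field; rewrite ?d0 ?s0.
  + by apply: is_derive_eq H _; rewrite Ez Ew; field; rewrite ?d0 ?s0.
  + by apply: is_derive_eq dw _; rewrite Ew; field; rewrite ?d0 ?s0.
- have H1 := is_der_div (is_der_cst (2 * a5) s) dz d0.
  (* The factor with constant -1 is t = - s, which the formula of s_5 contains explicitly. *)
  have H2 := is_der_div (is_derM (is_der_cst (-1) s) du) (is_derX2 dz) (expf_neq0 2 d0).
  have H := is_derD (is_derB dw H1) H2.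
  do 4?[case=> [_|]] => //=.
  + by apply: is_derive_eq dx _; rewrite Ex; field; rewrite ?d0 ?s0.
  + by apply: is_derive_eq dy _; rewrite Ey; field; rewrite ?d0 ?s0.
  + by apply: is_derive_eq dz _; rewrite Ez; field; rewrite ?d0 ?s0.
  + by apply: is_derive_eq H _; rewrite Ez Ew; field; rewrite ?d0 ?s0.
- move: d0; rewrite mulf_eq0 negb_or => /andP[x1 z1].
  have Dx := is_derB dx (is_der_cst 1 s); have Dz := is_derB dz (is_der_cst 1 s).
  have Hx := is_der_div dx Dx x1; have Hz := is_der_div dz Dz z1.
  have Hy := is_derM (is_derN Dx) (is_derD (is_derM Dx dy) (is_der_cst a2 s)).
  have Hw := is_derM (is_derN Dz) (is_derD (is_derM Dz dw) (is_der_cst a4 s)).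
  do 4?[case=> [_|]] => //=.
  + by apply: is_derive_eq Hx _; rewrite Ex /a0; field; rewrite ?x1 ?z1 ?s0.
  + by apply: is_derive_eq Hy _; rewrite Ex Ey /a0; field; rewrite ?x1 ?z1 ?s0.
  + by apply: is_derive_eq Hz _; rewrite Ez /a0; field; rewrite ?x1 ?z1 ?s0.
  + by apply: is_derive_eq Hw _; rewrite Ez Ew /a0; field; rewrite ?x1 ?z1 ?s0.
Qed.

End Velocity.

(* Clearing the denominator of a component of [generator i] exhibits its pole. *)
Lemma generator_polar_part (F : fieldType) (p : 11.-tuple F) :
  [/\ p`_0 - 1 != 0 ->
        (p`_1 - (generator 0 p)`_1) * (p`_0 - 1) = p`_5,
      p`_1 != 0 -> ((generator 2 p)`_0 - p`_0) * p`_1 = p`_7,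
      p`_0 - p`_2 != 0 ->
        (p`_1 - (generator 3 p)`_1) * (p`_0 - p`_2) = p`_8,
      p`_3 != 0 -> ((generator 4 p)`_2 - p`_2) * p`_3 = p`_9 &
      p`_2 != 0 ->
        ((generator 5 p)`_3 - p`_3) * p`_2 * p`_2 = p`_4 - 2 * p`_10 * p`_2].
Proof.
move: p; apply: tuple11_case => x y z w t a0 a1 a2 a3 a4 a5.
by split=> /= d0; field.
Qed.

(** On the loci x = 1 and z = 1 the right-hand sides equal 1, so both components have true poles
    there. *)
Lemma pi_polar_part (F : fieldType) (p : 11.-tuple F) :
  (p`_0 - 1 != 0 -> (generator 6 p)`_0 * (p`_0 - 1) = p`_0) /\
  (p`_2 - 1 != 0 -> (generator 6 p)`_2 * (p`_2 - 1) = p`_2).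
Proof.
move: p; apply: tuple11_case => x y z w t a0 a1 a2 a3 a4 a5.
by split=> /= d0; rewrite divfK.
Qed.

(** * Vanishing denominators are genuine poles *)

Section Poles.
Variable R : realType.
Local Notation C := R[i].
Local Notation coords := (coords R).
Local Notation L := {fraction {poly C}}.
Local Notation "q %:F" := (@FracField.tofrac {poly C} q).

Variable p : 11.-tuple C.
Hypothesis p_normalized : normalized p.
Local Notation phi := (meval (drop_alpha0 p)).

(* Moving the parameters off [p] along a line on which [alpha_0], [alpha_2],
   [alpha_3] and [alpha_4] do not vanish identically. *)
Definition perturbation : 11.-tuple {poly C} :=
  [tuple (p`_0)%:P; (p`_1)%:P; (p`_2)%:P; (p`_3)%:P; (p`_4)%:P;
         (p`_5)%:P + 'X; (p`_6)%:P - 7 * 'X; (p`_7)%:P + 'X; (p`_8)%:P + 'X;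
         (p`_9)%:P + 'X; (p`_10)%:P].

Definition perturb : {rmorphism polys R -> {poly C}} :=
  mmap (@polyC C) (drop_alpha0 perturbation).

Lemma perturb_horner0 f : (perturb f).[0] = phi f.
Proof.
elim/mpoly_closed: f => [c|k|f g Hf Hg|f g Hf Hg].
- by rewrite /= mmapC mevalC hornerC.
- rewrite /= mmapX mmap1U mevalXU !(drop_alpha0E 0).
  case: k => [[|[|[|[|[|[|[|[|[|[|//]]]]]]]]]] ?] /=; by rewrite !hornerE ?mulr0 ?subr0.
- by rewrite !rmorphD /= hornerD Hf Hg.
- by rewrite !rmorphM /= hornerM Hf Hg.
Qed.

Definition generic_perturb : {rmorphism polys R -> L} :=
  @FracField.tofrac {poly C} \o perturb.
Definition generic_perturbation : 11.-tuple L :=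
  map_tuple (@FracField.tofrac {poly C}) perturbation.

(** A denominator that is nonzero at ['X] = 0, that is at [p], is nonzero as a polynomial in
    ['X]. *)
Lemma regular_generic_perturb f v :
  regular phi f v -> exists u, regular generic_perturb f u.
Proof.
move=> [n [d [fE d0 _]]]; exists (generic_perturb n / generic_perturb d), n, d.
split=> //; rewrite /= tofrac_eq0; apply: contraNneq d0 => d0.
by have := perturb_horner0 d; rewrite [X in X.[0]]d0 horner0 => E; apply/eqP; exact: esym E.
Qed.

Lemma regular_coords_perturb : regular_at generic_perturb coords generic_perturbation.
Proof.
apply: regular_coords => [|k].
(* The coefficient -7 of alpha_1 balances the contributions 1 + 2 + 2 + 2 of alpha_0, alpha_2,
   alpha_3, alpha_4. *)
- rewrite /normalized /= p_normalized.
  rewrite -!(rmorph_nat (@FracField.tofrac {poly C})).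
  rewrite -(rmorph1 (@FracField.tofrac {poly C})) -!rmorphM -!rmorphB /=.
  congr (_%:F).
  by rewrite !rmorphB /= !rmorphM /= !rmorph_nat rmorph1; ring.
- rewrite /= mmapX mmap1U !(drop_alpha0E 0) (nth_map 0) // size_tuple.
  by case: k => [[|[|[|[|[|[|[|[|[|[|//]]]]]]]]]] ?].
Qed.

(* [f] would be [h / g] with [g] but not [h] vanishing *)
Lemma no_pole (f g h : ratfun R) u r :
  f * g = h -> regular phi f u -> regular generic_perturb g 0 ->
  regular generic_perturb h r -> r = 0.
Proof.
move=> <- /regular_generic_perturb[v fv] g0 hr.
by rewrite (regular_uniq hr (regularM fv g0)) mulr0.
Qed.

Local Notation G := generic_perturbation.
Local Notation iota c := ((c%:P)%:F).

Lemma addX_neq0 (c : C) : (c%:P + 'X)%:F != 0.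
Proof. by rewrite tofrac_eq0 addrC -size_poly_eq0 size_XaddC. Qed.

Lemma regular_perturb0 (f : ratfun R) (c : C) : c = 0 ->
  regular generic_perturb f (iota c) -> regular generic_perturb f 0.
Proof. by move=> ->; rewrite polyC0 rmorph0. Qed.

(** The denominator involves only x, y, z, w, which the perturbation leaves fixed, so if it vanishes
    at [p] it vanishes along the whole line. The polar part does not: it is alpha_j + ['X], or t for
    s_5, or 1 for [pi]. A component would then have a pole at [p], even where alpha_j = 0. *)
Lemma denominator_neq0 i : p`_4 != 0 ->
  (forall k, (k < 11)%N -> exists v, regular phi (generator i coords)`_k v) ->
  denominator i p != 0.
Proof.
move=> t0 reg.
have rp k : (k < 11)%N -> regular phi coords`_k p`_k := @regular_meval _ _ p_normalized k.
have rG := regular_coords_perturb.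
have [r0 r1 r2 r3] := And4 (rG 0%N isT) (rG 1%N isT) (rG 2%N isT) (rG 3%N isT).
have rB (f g : ratfun R) (a b : C) : regular generic_perturb f (iota a) ->
    regular generic_perturb g (iota b) -> regular generic_perturb (f - g) (iota (a - b)).
  by move=> fa gb; rewrite polyCB rmorphB; apply: regularB.
have rI : regular generic_perturb (1 : ratfun R) (iota (1 : C)).
  by rewrite polyC1 rmorph1; apply: (regular_nat _ 1).
have [polar0 polar2 polar3 polar4 polar5] := generator_polar_part coords.
have [polarx polarz] := pi_polar_part coords.
have D := denominator_coords R i.
apply/eqP; case: i reg D => [|[|[|[|[|[|i]]]]]] reg D d0.
- have [v rv] := reg 1%N isT.
  have g0 := regular_perturb0 d0 (rB _ _ _ _ r0 rI).
  have := no_pole (polar0 D) (regularB (rp 1%N isT) rv) g0 (rG 5%N isT).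
  exact/eqP/addX_neq0.
- by move/eqP: d0; rewrite oner_eq0.
- have [v rv] := reg 0%N isT.
  have g0 := regular_perturb0 d0 r1.
  have := no_pole (polar2 D) (regularB rv (rp 0%N isT)) g0 (rG 7%N isT).
  exact/eqP/addX_neq0.
- have [v rv] := reg 1%N isT.
  have g0 := regular_perturb0 d0 (rB _ _ _ _ r0 r2).
  have := no_pole (polar3 D) (regularB (rp 1%N isT) rv) g0 (rG 8%N isT).
  exact/eqP/addX_neq0.
- have [v rv] := reg 2%N isT.
  have g0 := regular_perturb0 d0 r3.
  have := no_pole (polar4 D) (regularB rv (rp 2%N isT)) g0 (rG 9%N isT).
  exact/eqP/addX_neq0.
- have [v rv] := reg 3%N isT.
  have g0 := regular_perturb0 d0 r2.
  have := no_pole (polar5 D) (regularM (regularB rv (rp 3%N isT)) (rp 2%N isT)) g0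
    (regularB (rG 4%N isT) (regularM (regularM (regular_nat _ 2) (rG 10%N isT)) g0)).
  (* With z = 0 the polar part t - 2 alpha_5 z reduces to t, nonzero by [t0]. *)
  rewrite mulr0 subr0; apply/eqP.
  have -> : G`_4 = iota p`_4 by [].
  by rewrite tofrac_eq0 polyC_eq0.
- have [Dx Dz] : coords`_0 - 1 != 0 /\ coords`_2 - 1 != 0.
    by apply/andP; rewrite -negb_or -mulf_eq0.
  move/eqP: d0; rewrite mulf_eq0 => /orP[] /eqP d0.
  + have [v rv] := reg 0%N isT.
    have g0 := regular_perturb0 d0 (rB _ _ _ _ r0 rI).
    have := no_pole (polarx Dx) rv g0 r0.
    have -> : G`_0 = iota p`_0 by [].
    rewrite (subr0_eq d0) polyC1 tofrac1.
    by apply/eqP; rewrite oner_eq0.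
  + have [v rv] := reg 2%N isT.
    have g0 := regular_perturb0 d0 (rB _ _ _ _ r2 rI).
    have := no_pole (polarz Dz) rv g0 r2.
    have -> : G`_2 = iota p`_2 by [].
    rewrite (subr0_eq d0) polyC1 tofrac1.
    by apply/eqP; rewrite oner_eq0.
Qed.

Lemma maps_to_generator i (q : 11.-tuple C) : p`_4 != 0 ->
  maps_to (generator i coords) p q -> denominator i p != 0 /\ q = generator i p.
Proof.
move=> t0 pq.
have rq k : (k < 11)%N -> regular phi (generator i coords)`_k q`_k.
  by move=> k11; rewrite !(nth_tnth _ _ k11); apply: pq.
have d0 : denominator i p != 0.
  by apply: denominator_neq0 => // k k11; exists q`_k; apply: rq.
split=> //; apply: eq_from_tnth => -[k k11]; rewrite -!(nth_tnth 0).
apply: regular_uniq (rq k k11) _.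
exact: (regular_generator d0 (regular_meval p_normalized)).
Qed.

End Poles.

(** * The Bäcklund property of the generators *)

Section Backlund.
Variable R : realType.
Local Notation C := R[i].

Lemma mk_point_normalized (X : 4.-tuple C) t (a : 6.-tuple C) :
  linear_relation a -> normalized (mk_point X t a).
Proof.
rewrite /linear_relation; case: a => -[|a0 [|a1 [|a2 [|a3 [|a4 [|a5 []]]]]]] // sa.
case: X => -[|x [|y [|z [|w []]]]] // sX; rewrite /normalized /= => E.
by rewrite -[X in _ = X - _ - _ - _ - _ - _]E; ring.
Qed.

Lemma velocity_mk_point (X : 4.-tuple C) t (a : 6.-tuple C) :
  vector_field a t X = velocity (mk_point X t a).
Proof.
case: a => -[|a0 [|a1 [|a2 [|a3 [|a4 [|a5 []]]]]]] // sa.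
by case: X => -[|x [|y [|z [|w []]]]] // sX; apply: val_inj.
Qed.

(** The parameters transform independently of x, y, z, w, t, so they are read off at the origin;
    divisions by zero there affect only discarded coordinates. *)
Definition new_parameters i (a : 6.-tuple C) : 6.-tuple C :=
  [tuple (generator i (mk_point [tuple 0; 0; 0; 0] 0 a))`_(5 + k) | k < 6].

Lemma generator_mk_point i (X : 4.-tuple C) t a :
  generator i (mk_point X t a) =
  mk_point [tuple (generator i (mk_point X t a))`_k | k < 4]
    (time_sign _ i * t) (new_parameters i a).
Proof.
case: a => -[|a0 [|a1 [|a2 [|a3 [|a4 [|a5 []]]]]]] // sa.
case: X => -[|x [|y [|z [|w []]]]] // sX.
rewrite /new_parameters /time_sign.
by case: i => [|[|[|[|[|[|i]]]]]]; apply: val_inj;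
  rewrite /= !enum_ordSl !enum_ord0 /= ?mul1r ?mulN1r.
Qed.

Lemma new_parameters_relation i a :
  linear_relation a -> linear_relation (new_parameters i a).
Proof.
move=> /(mk_point_normalized [tuple 0; 0; 0; 0] 0) /(generator_normalized i).
rewrite generator_mk_point; move: [tuple _ | k < 4] (new_parameters i a) => X b.
rewrite /normalized /linear_relation.
case: X => -[|x [|y [|z [|w []]]]] // sX.
case: b => -[|b0 [|b1 [|b2 [|b3 [|b4 [|b5 []]]]]]] // sb /= ->; ring.
Qed.

Lemma mk_point_inj (X Y : 4.-tuple C) s t (a b : 6.-tuple C) :
  mk_point X s a = mk_point Y t b -> [/\ X = Y, s = t & a = b].
Proof.
move=> /(congr1 val) /= /eqP; rewrite eqseq_cat ?size_tuple // => /andP[/eqP XY].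
by case/eqP => -> ab; split=> //; apply: val_inj.
Qed.

Lemma mk_point_eta (X : 4.-tuple C) t (a : 6.-tuple C) : mk_point X t a =
  [tuple X`_0; X`_1; X`_2; X`_3; t; a`_0; a`_1; a`_2; a`_3; a`_4; a`_5].
Proof.
case: a => -[|a0 [|a1 [|a2 [|a3 [|a4 [|a5 []]]]]]] // sa.
by case: X => -[|x [|y [|z [|w []]]]] // sX; apply: val_inj.
Qed.

Lemma is_backlund_generator i : is_backlund (generator i (coords R)).
Proof.
move=> a la; exists (new_parameters i a); first exact: new_parameters_relation.
move=> U X [_ U0 dX] V theta Y A oV H.
pose e := time_sign C i.
have ee s : e * (e * s) = s.
  by rewrite /e /time_sign; case: ifP => _; rewrite ?mul1r // !mulN1r opprK.
pose P s := mk_point (X (e * s)) (e * s) a.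
(* The time coordinate of [maps_to] forces the branch [theta] to be s |-> e s; time is nonzero since
   [U] omits 0, so [maps_to_generator] gives [Y] and [A] by the formulas. *)
have HV s : V s -> [/\ U (e * s), denominator i (P s) != 0,
    Y s = [tuple (generator i (P s))`_k | k < 4] & A s = new_parameters i a].
  move=> /H[Ut _ m]; have t0 : theta s != 0 by apply: contra_notN U0 => /eqP <-.
  have nP := mk_point_normalized (X (theta s)) (theta s) la.
  have p4 : (mk_point (X (theta s)) (theta s) a)`_4 = theta s.
    by rewrite mk_point_eta.
  have [|d0] := maps_to_generator nP _ m; first by rewrite p4.
  rewrite generator_mk_point => /mk_point_inj[YE sE AE].
  have tE : theta s = e * s by rewrite -[LHS]ee; congr (_ * _); apply: esym.
  by rewrite /P -tE; split.
split; last by move=> s /HV[].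
split=> // [/HV[]|s Vs k]; first by rewrite mulr0.
have [Us d0 YE AE] := HV s Vs.
rewrite velocity_mk_point.
have -> : mk_point (Y s) s (new_parameters i a) = generator i (P s).
  by rewrite generator_mk_point YE ee.
have Yk u : V u -> tnth (Y u) k = (generator i (P u))`_k.
  by move=> /HV[_ _ -> _]; rewrite tnth_mktuple.
(* [Y] is prescribed only on [V]; as [V] is open, it agrees with the formulas near [s] and has the
   same derivative. *)
apply: (@near_eq_is_derive C C^o C^o (fun u : C^o => (generator i (P u))`_k : C^o)).
  by near=> u; rewrite Yk //; near: u; apply: open_nbhs_nbhs; split.
rewrite (tnth_nth 0).
have dx (j : 'I_4) : is_derive (s : C^o) 1 (fun u : C^o => (X (e * u))`_j : C^o)
    (e * (velocity (P s))`_j : C^o).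
  have := is_der_time_sign (i := i) (dX _ Us j).
  rewrite velocity_mk_point (tnth_nth 0); apply: near_eq_is_derive.
  by near=> u; rewrite (tnth_nth 0).
have nP := mk_point_normalized (X (e * s)) (e * s) la.
have s0 : s != 0 by apply: contra_notN U0 => /eqP s0; rewrite s0 mulr0 in Us.
have PE : P = fun u => [tuple (X (e * u))`_0; (X (e * u))`_1; (X (e * u))`_2;
    (X (e * u))`_3; e * u; a`_0; a`_1; a`_2; a`_3; a`_4; a`_5].
  by apply/funext => u; rewrite /P mk_point_eta.
have velE (q : 11.-tuple C) : [seq e * v | v <- velocity q] =
  [:: e * (velocity q)`_0; e * (velocity q)`_1; e * (velocity q)`_2; e * (velocity q)`_3] by [].
move: d0 nP dx (velE (P s)) => {Yk YE HV velE}.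
rewrite -/(P s) PE => d0 nP dx vE.
exact: (generator_velocity nP s0 d0 (dx 0) (dx 1) (dx 2) (dx 3) (esym vE) (ltn_ord k)).
Unshelve. all: by end_near.
Qed.

End Backlund.

Theorem theorem5p1 (R : realType) :
  [/\ (forall i : 'I_6, acts_by (refl_s R i)) /\ acts_by (diag_pi R),
      (forall i : 'I_6, is_backlund (refl_s R i)) /\ is_backlund (diag_pi R),
      forall u v : seq 'I_6,
        (forall f : ratfun R, act_word u f = act_word v f) <-> coxeter_eq u v &
      [/\ forall f : ratfun R, act (diag_pi R) (act (diag_pi R) f) = f,
          forall f : ratfun R,
            act (diag_pi R) (act (refl_s R (inord 0)) f)
            = act (refl_s R (inord 1)) (act (diag_pi R) f) &
          forall (i : 'I_6) (f : ratfun R), (2 <= i)%N ->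
            act (diag_pi R) (act (refl_s R i) f) = act (refl_s R i) (act (diag_pi R) f)]].
Proof.
split.
- by split=> [i|]; rewrite ?refl_generator ?pi_generator; apply: acts_by_generator.
- by split=> [i|]; rewrite ?refl_generator ?pi_generator; apply: is_backlund_generator.
- by move=> u v; split; [apply: coxeter_faithful | apply: coxeter_eq_act].
- by split; [apply: act_pi | apply: act_pi_refl0 | apply: act_pi_refl].
Qed.
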